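(* Let $\ell,\ell'$ be geodesic lines of $\mathbb{H}^2$ and $g,g'\in G_0$. Consider: (A) the left $\mathrm{AdS}$ crooked planes $g\mathsf{C}(\ell)$ and $g'\mathsf{C}(\ell')$ are disjoint; (B) the geodesic lines $g\cdot\ell$ and $g'\cdot\ell'$ are disjoint, and $g^{-1}g'\in\mathsf{SQ}(\ell)^{-1}\mathsf{SQ}(\ell')$, where $\ell,\ell'$ carry the transverse orientations that $g,g'$ take to transverse orientations of $g\cdot\ell$, $g'\cdot\ell'$ pointing away from each other. Then (A) implies (B). Moreover, if $\ell$ and $\ell'$ are disjoint and (with these transverse orientations) transversely oriented away from each other, then (B) implies (A).
   Context: $G_0=\mathrm{PSL}_2(\mathbb{R})$ acts on the hyperbolic plane $\mathbb{H}^2$; $\mathrm{AdS}^3$ is identified with $G_0$. For a geodesic line $\ell$ with closure $\overline\ell$ in $\mathbb{H}^2\cup\partial_\infty\mathbb{H}^2$, $\mathsf{C}(\ell)$ is the set of $h\in G_0$ having a nonrepelling fixed point in $\overline\ell$ (identity: every point; elliptic: its fixed point; parabolic: its fixed point at infinity; hyperbolic: its attracting fixed point). For a transversely oriented geodesic line $\ell$, the stem quadrant $\mathsf{SQ}(\ell)\subset G_0$ is the set of hyperbolic elements whose translation axis is orthogonal to $\ell$ and which translate towards the positive side of $\ell$. For subsets $A,B\subset G_0$, $AB=\{ab\}$ and $A^{-1}=\{a^{-1}\}$. *)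

(* Defs.v *)
From Stdlib Require Import Reals.
Open Scope R_scope.

(** * G_0 = PSL_2(R): elements are represented by SL_2(R) matrices
    [[ma, mb], [mc, md]]; two matrices represent the same element of
    PSL_2(R) iff they are equal up to sign ([peq]). All subsets of G_0
    below are given by sign-invariant predicates on matrices. *)
Record mat := Mat { ma : R; mb : R; mc : R; md : R }.

Definition SL2 (m : mat) : Prop := ma m * md m - mb m * mc m = 1.

Definition mmul (m n : mat) : mat :=
  Mat (ma m * ma n + mb m * mc n) (ma m * mb n + mb m * md n)
      (mc m * ma n + md m * mc n) (mc m * mb n + md m * md n).

Definition minv (m : mat) : mat := Mat (md m) (- mb m) (- mc m) (ma m).

Definition mopp (m : mat) : mat := Mat (- ma m) (- mb m) (- mc m) (- md m).

Definition mid : mat := Mat 1 0 0 1.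

Definition peq (m n : mat) : Prop := m = n \/ m = mopp n.

Definition tr (m : mat) : R := ma m + md m.

Definition is_identity (m : mat) : Prop := peq m mid.
Definition elliptic (m : mat) : Prop := Rabs (tr m) < 2.
Definition parabolic (m : mat) : Prop := Rabs (tr m) = 2 /\ ~ is_identity m.
Definition hyperbolic (m : mat) : Prop := Rabs (tr m) > 2.

Definition pt := (R * R)%type.          (* z = x + i y *)
Definition H2 (z : pt) : Prop := 0 < snd z.

Inductive bpt := Fin (x : R) | Inf.

(** Möbius action on H^2 : z |-> (a z + b)/(c z + d) *)
Definition act (m : mat) (z : pt) : pt :=
  let x := fst z in let y := snd z in
  let den := (mc m * x + md m) ^ 2 + (mc m * y) ^ 2 in
  (((ma m * x + mb m) * (mc m * x + md m) + ma m * mc m * y ^ 2) / den,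
   y * (ma m * md m - mb m * mc m) / den).

Definition act_b (m : mat) (e : bpt) : bpt :=
  match e with
  | Fin x => if Req_EM_T (mc m * x + md m) 0 then Inf
             else Fin ((ma m * x + mb m) / (mc m * x + md m))
  | Inf => if Req_EM_T (mc m) 0 then Inf else Fin (ma m / mc m)
  end.

Definition bvec (e : bpt) : R * R :=
  match e with Fin x => (x, 1) | Inf => (1, 0) end.

(** [e] is the attracting fixed point of the hyperbolic [m]: it is the
    projective class of an eigenvector whose eigenvalue has modulus > 1. *)
Definition attracting (m : mat) (e : bpt) : Prop :=
  exists lam, 1 < lam * lam /\
    ma m * fst (bvec e) + mb m * snd (bvec e) = lam * fst (bvec e) /\
    mc m * fst (bvec e) + md m * snd (bvec e) = lam * snd (bvec e).

Record geod := Geod { ep1 : bpt; ep2 : bpt; ep_neq : ep1 <> ep2 }.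

(** defining function of the geodesic with endpoints p, q:
    ℓ = { z ∈ H^2 | gfun z = 0 }, and its sign separates the two sides. *)
Definition gfun (p q : bpt) (z : pt) : R :=
  let x := fst z in let y := snd z in
  match p, q with
  | Fin a, Fin b => (x - a) * (x - b) + y ^ 2
  | Fin a, Inf => x - a
  | Inf, Fin b => x - b
  | Inf, Inf => 1
  end.

(** its Euclidean gradient (the upper half-plane model is conformal) *)
Definition ggrad (p q : bpt) (z : pt) : R * R :=
  match p, q with
  | Fin a, Fin b => (2 * fst z - a - b, 2 * snd z)
  | _, _ => (1, 0)
  end.

Definition on_pq (p q : bpt) (z : pt) : Prop := H2 z /\ gfun p q z = 0.
Definition on (l : geod) (z : pt) : Prop := on_pq (ep1 l) (ep2 l) z.

(** endpoints: the closure of ℓ in H^2 ∪ ∂H^2 is ℓ ∪ {ep1, ep2} *)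
Definition is_endpoint (l : geod) (e : bpt) : Prop := e = ep1 l \/ e = ep2 l.

(** Transverse orientations of ℓ: a boolean [s] choosing the positive side. *)
Definition pos_side (l : geod) (s : bool) (z : pt) : Prop :=
  H2 z /\ (if s then gfun (ep1 l) (ep2 l) z > 0 else gfun (ep1 l) (ep2 l) z < 0).
Definition neg_side (l : geod) (s : bool) (z : pt) : Prop := pos_side l (negb s) z.

(** * C(ℓ): elements with a nonrepelling fixed point in the closure of ℓ *)
Definition Cset (l : geod) (h : mat) : Prop :=
  is_identity h
  \/ (elliptic h /\ exists z, on l z /\ act h z = z)
  \/ (parabolic h /\ exists e, is_endpoint l e /\ act_b h e = e)
  \/ (hyperbolic h /\ exists e, is_endpoint l e /\ attracting h e).

(** * Stem quadrant SQ(ℓ) for ℓ transversely oriented by s: hyperbolic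
    elements whose translation axis (the geodesic joining its two fixed
    points at infinity) is orthogonal to ℓ, translating towards the
    positive side of ℓ (i.e. moving the point axis ∩ ℓ into the positive
    side). *)
Definition SQ (l : geod) (s : bool) (h : mat) : Prop :=
  hyperbolic h /\
  exists p q : bpt, p <> q /\ act_b h p = p /\ act_b h q = q /\
    exists z, on_pq p q z /\ on l z /\
      fst (ggrad p q z) * fst (ggrad (ep1 l) (ep2 l) z)
      + snd (ggrad p q z) * snd (ggrad (ep1 l) (ep2 l) z) = 0 /\
      pos_side l s (act h z).

Definition crooked_disjoint (g : mat) (l : geod) (g' : mat) (l' : geod) : Prop :=
  forall h h', SL2 h -> SL2 h' -> Cset l h -> Cset l' h' ->
    ~ peq (mmul g h) (mmul g' h').

Definition geod_disjoint (l l' : geod) : Prop :=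
  forall z, on l z -> ~ on l' z.

Definition img_disjoint (g : mat) (l : geod) (g' : mat) (l' : geod) : Prop :=
  forall z w, on l z -> on l' w -> act g z <> act g' w.

Definition img_away (g : mat) (l : geod) (s : bool)
                    (g' : mat) (l' : geod) (s' : bool) : Prop :=
  (forall w, on l' w -> exists z, neg_side l s z /\ act g z = act g' w) /\
  (forall z, on l z -> exists w, neg_side l' s' w /\ act g' w = act g z).

Definition oriented_away (l : geod) (s : bool) (l' : geod) (s' : bool) : Prop :=
  (forall w, on l' w -> neg_side l s w) /\ (forall z, on l z -> neg_side l' s' z).

Definition in_SQ_quot (g g' : mat) (l : geod) (s : bool) (l' : geod) (s' : bool) : Prop :=
  exists u v, SL2 u /\ SL2 v /\ SQ l s u /\ SQ l' s' v /\
    peq (mmul (minv g) g') (mmul (minv u) v).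

Definition condB_with (l : geod) (s : bool) (l' : geod) (s' : bool) (g g' : mat) : Prop :=
  img_disjoint g l g' l' /\ img_away g l s g' l' s' /\ in_SQ_quot g g' l s l' s'.

(** (B): the orientations are those determined by the geometry *)
Definition condB (l l' : geod) (g g' : mat) : Prop :=
  img_disjoint g l g' l' /\
  exists s s', img_away g l s g' l' s' /\ in_SQ_quot g g' l s l' s'.

(* Main.v *)
Require Import Defs.
From Stdlib Require Import Reals Lra Psatz Nsatz.
Open Scope R_scope.

(** Put [k = g^-1 g'] and let [x ^ y] be the area form on [R^2], whose vectors
    represent horoballs. Disjointness of the crooked planes is equivalent to the
    four inequalities [|e ^ e'| < |e ^ k e'|], where [e], [e'] run over the
    endpoints of the two lines: points [z], [z'] of the closed lines are
    nonnegative combinations of the forms [e e^T], so these inequalities say that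
    [k] lengthens [d(z, z')], which excludes [h = k h'] with [h], [h'] not moving
    away from [z], [z']; conversely, an inequality that fails yields such [h], [h'].
    Given the inequalities, the matrices [x = (e ^ e')] and [X = (e ^ k e')] have
    the same determinant and [X = U x V^T] is solved explicitly by symmetric
    translations [U], [V], which gives [k = u^-1 v] up to sign and the
    disjointness and orientations of the images. Conversely an element of the
    stem quadrant increases [|e ^ f|] for every [f] on the negative side. *)

(** * Factoring a 2x2 matrix through two translations *)

(** This is [E] X = U x V^T with U = [[D, c], [b, D]] and V = [[D, c'], [b', D]], both of
    determinant [E]. The two expressions for [D] agree because x and X have equal determinants. *)
Lemma factor_identity (x11 x12 x21 x22 X11 X12 X21 X22 D : R) :
  D = X11 * X22 - x11 * x22 -> D = X12 * X21 - x12 * x21 ->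
  let c := (X11 - x11) * (X12 - x12) in
  let b := (X22 - x22) * (X21 - x21) in
  let c' := (X11 - x11) * (X21 - x21) in
  let b' := (X22 - x22) * (X12 - x12) in
  let E := D * D - b * c in
  E * X11 = D * D * x11 + D * c' * x12 + c * D * x21 + c * c' * x22 /\
  E * X12 = D * b' * x11 + D * D * x12 + c * b' * x21 + c * D * x22 /\
  E * X21 = b * D * x11 + b * c' * x12 + D * D * x21 + D * c' * x22 /\
  E * X22 = b * b' * x11 + b * D * x12 + D * b' * x21 + D * D * x22.
Proof.
  intros H1 H2 c b c' b' E. unfold E, c, b, c', b'.
  assert (H : X11 * X22 - x11 * x22 = X12 * X21 - x12 * x21) by lra.
  clear E c b c' b'. repeat split; nsatz.
Qed.

Lemma sqr_lt_mul_sub_pos (x X : R) : x * x < X * X -> 0 < X * (X - x).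
Proof. intros H. nra. Qed.

Lemma mul_pos_cancel (a b : R) : 0 < a -> 0 < a * b -> 0 < b.
Proof. intros; nra. Qed.

Lemma sqr_cancel (w z : R) : 0 < (w * w) * z -> 0 < z.
Proof. intros H. pose proof (Rle_0_sqr w) as P. unfold Rsqr in P. nra. Qed.

Lemma sign_product (X Y a b : R) :
  0 < X * a -> 0 < Y * b -> 0 < (X * Y) * (a * b).
Proof.
  intros H1 H2. replace (X * Y * (a * b)) with ((X * a) * (Y * b)) by ring.
  now apply Rmult_lt_0_compat.
Qed.

Lemma sign_trans (x y z : R) : 0 < x * y -> 0 < y * z -> 0 < x * z.
Proof.
  intros H1 H2. apply (mul_pos_cancel (y * y)).
  - nra.
  - replace (y * y * (x * z)) with ((x * y) * (y * z)) by ring.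
    now apply Rmult_lt_0_compat.
Qed.

(** The factorisation needs E > 0, and replacing x by -x is allowed since matrices count up to sign.
    If both signs failed, D^2 would bound [a1 * b1] and [a2 * b2] from below, while [a1 * a2] and
    [b1 * b2] are at most D^2, each being D^2 minus a square. *)
Lemma one_sign_positive (x11 x12 x21 x22 X11 X12 X21 X22 : R) :
  x11 * x11 < X11 * X11 -> x12 * x12 < X12 * X12 ->
  x21 * x21 < X21 * X21 -> x22 * x22 < X22 * X22 ->
  X11 * X22 - X12 * X21 = x11 * x22 - x12 * x21 ->
  x11 * x22 - x12 * x21 <> 0 ->
  0 < (X11 * X22) * (X12 * X21) ->
  let D := X11 * X22 - x11 * x22 in
  0 < D * D - ((X22 - x22) * (X21 - x21)) * ((X11 - x11) * (X12 - x12)) \/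
  0 < D * D - ((X22 + x22) * (X21 + x21)) * ((X11 + x11) * (X12 + x12)).
Proof.
  intros H11 H12 H21 H22 Hdet Hd HX D.
  assert (HD : D = X12 * X21 - x12 * x21) by (unfold D; lra).
  set (a1 := (X11 - x11) * (X22 - x22)). set (a2 := (X11 + x11) * (X22 + x22)).
  set (b1 := (X12 - x12) * (X21 - x21)). set (b2 := (X12 + x12) * (X21 + x21)).
  assert (P : forall x X, x * x < X * X -> 0 < X * (X + x)) by (intros; nra).
  assert (A1 : 0 < (X11 * X22) * a1) by (apply sign_product; now apply sqr_lt_mul_sub_pos).
  assert (A2 : 0 < (X11 * X22) * a2) by (apply sign_product; now apply P).
  assert (B1 : 0 < (X12 * X21) * b1) by (apply sign_product; now apply sqr_lt_mul_sub_pos).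
  assert (B2 : 0 < (X12 * X21) * b2) by (apply sign_product; now apply P).
  assert (AB1 : 0 < a1 * b1).
  { apply sign_trans with (X12 * X21); [|exact B1].
    rewrite Rmult_comm. apply sign_trans with (X11 * X22); lra. }
  assert (AB2 : 0 < a2 * b2).
  { apply sign_trans with (X12 * X21); [|exact B2].
    rewrite Rmult_comm. apply sign_trans with (X11 * X22); lra. }
  assert (AA : 0 < a1 * a2) by (apply sign_trans with (X11 * X22); lra).
  assert (BB : 0 < b1 * b2) by (apply sign_trans with (X12 * X21); lra).
  assert (LA : a1 * a2 <= D * D).
  { unfold a1, a2, D. pose proof (Rle_0_sqr (X11 * x22 - X22 * x11)) as S. unfold Rsqr in S. nra. }
  assert (LB : b1 * b2 <= D * D).
  { rewrite HD. unfold b1, b2. pose proof (Rle_0_sqr (X12 * x21 - X21 * x12)) as S.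
    unfold Rsqr in S. nra. }
  destruct (Rlt_le_dec 0 (D * D - b1 * a1)) as [L|N1].
  { left. replace (D * D - _) with (D * D - b1 * a1) by (unfold a1, b1; ring). exact L. }
  destruct (Rlt_le_dec 0 (D * D - b2 * a2)) as [L|N2].
  { right. replace (D * D - _) with (D * D - b2 * a2) by (unfold a2, b2; ring). exact L. }
  exfalso.
  set (Q := D * D) in *.
  assert (Qp : 0 < Q) by lra.
  (* [Q^2 <= (a1 b1)(a2 b2) = (a1 a2)(b1 b2) <= Q^2], so all four products equal [Q]. *)
  assert (M : (b1 * a1) * (b2 * a2) <= Q * Q).
  { replace (b1 * a1 * (b2 * a2)) with ((a1 * a2) * (b1 * b2)) by ring.
    apply Rmult_le_compat; lra. }
  assert (E1 : b1 * a1 = Q) by nra.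
  assert (E2 : b2 * a2 = Q) by nra.
  assert (E3 : a1 * a2 = Q).
  { assert ((a1 * a2) * (b1 * b2) = Q * Q).
    { replace (a1 * a2 * (b1 * b2)) with ((b1 * a1) * (b2 * a2)) by ring.
      rewrite E1, E2. ring. }
    nra. }
  assert (F1 : b1 = a2) by (apply Rmult_eq_reg_r with a1; [lra | nra]).
  assert (F2 : b2 = a1) by (apply Rmult_eq_reg_r with a2; [lra | nra]).
  (* Adding [F1] and [F2] gives det X + det x = 0, although the two determinants are equal and
     nonzero. *)
  apply Hd. unfold a1, a2, b1, b2 in F1, F2. lra.
Qed.

(** The factors of [factor_identity] are scaled to determinant 1. The sign conditions on [a * c] and
    [a' * c'] record the directions of the two translations, from which the transverse orientations
    are later read. *)
Lemma factor_translations (x11 x12 x21 x22 X11 X12 X21 X22 : R) :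
  x11 * x11 < X11 * X11 -> x12 * x12 < X12 * X12 ->
  x21 * x21 < X21 * X21 -> x22 * x22 < X22 * X22 ->
  X11 * X22 - X12 * X21 = x11 * x22 - x12 * x21 ->
  x11 * x22 - x12 * x21 <> 0 ->
  0 < (X11 * X22) * (X12 * X21) ->
  exists s a b c a' b' c', s * s = 1 /\
    a * a - b * c = 1 /\ a' * a' - b' * c' = 1 /\ 0 < b * c /\ 0 < b' * c' /\
    0 < (a * c) * (X11 * X21) /\ 0 < (a' * c') * (X11 * X12) /\
    X11 = s * (a * a' * x11 + a * c' * x12 + c * a' * x21 + c * c' * x22) /\
    X12 = s * (a * b' * x11 + a * a' * x12 + c * b' * x21 + c * a' * x22) /\
    X21 = s * (b * a' * x11 + b * c' * x12 + a * a' * x21 + a * c' * x22) /\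
    X22 = s * (b * b' * x11 + b * a' * x12 + a * b' * x21 + a * a' * x22).
Proof.
  intros H11 H12 H21 H22 Hdet Hd HX.
  assert (K : exists s, s * s = 1 /\
    0 < (X11 * X22 - x11 * x22) * (X11 * X22 - x11 * x22)
      - ((X22 - s * x22) * (X21 - s * x21)) * ((X11 - s * x11) * (X12 - s * x12))).
  { destruct (one_sign_positive _ _ _ _ _ _ _ _ H11 H12 H21 H22 Hdet Hd HX) as [L|L].
    - exists 1. split; [ring|]. rewrite !Rmult_1_l. exact L.
    - exists (-1). split; [ring|]. eapply Rlt_le_trans; [exact L|]. right. ring. }
  destruct K as [s [Hs HE]].
  assert (Hsx : forall x y, (s * x) * (s * y) = x * y)
    by (intros; replace (s * x * (s * y)) with (s * s * (x * y)) by ring; rewrite Hs; ring).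
  set (D := X11 * X22 - x11 * x22) in *.
  assert (PD : 0 < (X11 * X22) * D).
  { apply sqr_lt_mul_sub_pos.
    replace (x11 * x22 * (x11 * x22)) with ((x11 * x11) * (x22 * x22)) by ring.
    replace (X11 * X22 * (X11 * X22)) with ((X11 * X11) * (X22 * X22)) by ring.
    apply Rmult_le_0_lt_compat; nra. }
  destruct (factor_identity (s * x11) (s * x12) (s * x21) (s * x22) X11 X12 X21 X22 D)
    as [I1 [I2 [I3 I4]]].
  { rewrite Hsx. reflexivity. }
  { rewrite Hsx. unfold D. lra. }
  rewrite <- Hsx in H11, H12, H21, H22.
  apply sqr_lt_mul_sub_pos in H11, H12, H21, H22.
  set (c := (X11 - s * x11) * (X12 - s * x12)) in *.
  set (b := (X22 - s * x22) * (X21 - s * x21)) in *.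
  set (c' := (X11 - s * x11) * (X21 - s * x21)) in *.
  set (b' := (X22 - s * x22) * (X12 - s * x12)) in *.
  (* The determinants of the two factors agree, so a single scalar [r] normalises both. *)
  assert (Hbc : b' * c' = b * c) by (unfold b, c, b', c'; ring).
  assert (Pc : 0 < (X11 * X12) * c) by now apply sign_product.
  assert (Pb : 0 < (X22 * X21) * b) by now apply sign_product.
  assert (Pc' : 0 < (X11 * X21) * c') by now apply sign_product.
  assert (Pbc : 0 < b * c).
  { apply sign_trans with (X11 * X12); [|lra].
    rewrite Rmult_comm. apply sign_trans with (X22 * X21); [|lra].
    eapply Rlt_le_trans; [exact HX|]. right; ring. }
  set (E := D * D - b * c) in *.
  set (r := / sqrt E).
  assert (Hr : r * r * E = 1).
  { unfold r. rewrite <- (sqrt_sqrt E) at 3 by lra. field.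
    apply Rgt_not_eq. now apply sqrt_lt_R0. }
  assert (Hr2 : 0 < r * r) by nra.
  assert (sc : forall x, 0 < x -> 0 < (r * r) * x) by (intros; now apply Rmult_lt_0_compat).
  assert (div : forall x y, E * x = y -> x = r * r * y).
  { intros x y <-. transitivity (r * r * E * x); [rewrite Hr|]; ring. }
  apply div in I1, I2, I3, I4.
  exists s, (r * D), (r * b), (r * c), (r * D), (r * b'), (r * c').
  split; [exact Hs|].
  split; [rewrite <- Hr; unfold E; ring|].
  split; [rewrite <- Hr; unfold E; rewrite <- Hbc; ring|].
  split; [replace (r * b * (r * c)) with (r * r * (b * c)) by ring; now apply sc|].
  split; [replace (r * b' * (r * c')) with (r * r * (b' * c')) by ring;
          apply sc; now rewrite Hbc|].
  (* [D] has the sign of [X11 * X22], [c] that of [X11 * X12] and [c'] that of [X11 * X21]; together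
     with [HX] this fixes the signs of [D * c] and [D * c']. *)
  assert (T : forall p q, 0 < p -> 0 < q -> 0 < p * q * ((X11 * X22) * (X12 * X21)))
    by (intros; apply Rmult_lt_0_compat; [now apply Rmult_lt_0_compat | exact HX]).
  split.
  { replace (r * D * (r * c) * (X11 * X21)) with (r * r * ((D * c) * (X11 * X21))) by ring.
    apply sc, (sqr_cancel (X11 * X22 * X12)).
    eapply Rlt_le_trans; [exact (T _ _ PD Pc)|]. right; ring. }
  split.
  { replace (r * D * (r * c') * (X11 * X12)) with (r * r * ((D * c') * (X11 * X12))) by ring.
    apply sc, (sqr_cancel (X11 * X22 * X21)).
    eapply Rlt_le_trans; [exact (T _ _ PD Pc')|]. right; ring. }
  repeat split; etransitivity; [exact I1|ring|exact I2|ring|exact I3|ring|exact I4|ring].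
Qed.

(** * Planar vectors and the upper half-plane *)

Definition wedge (v w : R * R) : R := fst v * snd w - snd v * fst w.

Definition lc (a : R) (v : R * R) (b : R) (w : R * R) : R * R :=
  (a * fst v + b * fst w, a * snd v + b * snd w).

Definition mapp (m : mat) (v : R * R) : R * R :=
  (ma m * fst v + mb m * snd v, mc m * fst v + md m * snd v).

(* The sign at infinity is opposite to that of [bvec], so that [gfun_polar]
   needs no case distinction. *)
Definition evec (e : bpt) : R * R :=
  match e with Fin x => (x, 1) | Inf => (-1, 0) end.

(* [Re ((p1 - z p2) * conj (q1 - z q2))], where [z = x + i y]. *)
Definition polar (p q : R * R) (z : pt) : R :=
  (fst p - fst z * snd p) * (fst q - fst z * snd q) + snd z ^ 2 * snd p * snd q.

Ltac vec := unfold mapp, lc, wedge, polar in *; simpl in *.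

Lemma gfun_polar p q z : gfun p q z = polar (evec p) (evec q) z.
Proof. destruct p, q; unfold gfun, polar; simpl; ring. Qed.

Lemma mat_ext m n :
  ma m = ma n -> mb m = mb n -> mc m = mc n -> md m = md n -> m = n.
Proof. destruct m, n; simpl; intros; subst; reflexivity. Qed.

Lemma wedge_mapp m v w : SL2 m -> wedge (mapp m v) (mapp m w) = wedge v w.
Proof.
  intros H. unfold SL2 in H. vec.
  transitivity ((ma m * md m - mb m * mc m) * (fst v * snd w - snd v * fst w)).
  - ring.
  - rewrite H. ring.
Qed.

Lemma mapp_mmul m n v : mapp (mmul m n) v = mapp m (mapp n v).
Proof. vec. f_equal; ring. Qed.

Lemma mapp_lc m a v b w : mapp m (lc a v b w) = lc a (mapp m v) b (mapp m w).
Proof. vec. f_equal; ring. Qed.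

Lemma wedge_lc_l a v b w u : wedge (lc a v b w) u = a * wedge v u + b * wedge w u.
Proof. vec. ring. Qed.

Lemma wedge_lc_r a v b w u : wedge u (lc a v b w) = a * wedge u v + b * wedge u w.
Proof. vec. ring. Qed.

Lemma wedge_self v : wedge v v = 0.
Proof. vec. ring. Qed.

Lemma wedge_anti v w : wedge v w = - wedge w v.
Proof. vec. ring. Qed.

Lemma SL2_mmul m n : SL2 m -> SL2 n -> SL2 (mmul m n).
Proof.
  unfold SL2. intros Hm Hn. simpl.
  transitivity ((ma m * md m - mb m * mc m) * (ma n * md n - mb n * mc n)).
  - ring.
  - rewrite Hm, Hn. ring.
Qed.

Lemma SL2_minv m : SL2 m -> SL2 (minv m).
Proof. unfold SL2. simpl. lra. Qed.

Lemma SL2_mid : SL2 mid.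
Proof. unfold SL2. simpl. ring. Qed.

Lemma mmul_assoc m n o : mmul m (mmul n o) = mmul (mmul m n) o.
Proof. apply mat_ext; simpl; ring. Qed.

Lemma mmul_minv_l m : SL2 m -> mmul (minv m) m = mid.
Proof. intros H. unfold SL2 in H. apply mat_ext; simpl; lra. Qed.

Lemma mmul_minv_r m : SL2 m -> mmul m (minv m) = mid.
Proof. intros H. unfold SL2 in H. apply mat_ext; simpl; lra. Qed.

Lemma mmul_mid_l m : mmul mid m = m.
Proof. apply mat_ext; simpl; ring. Qed.

Lemma mmul_mid_r m : mmul m mid = m.
Proof. apply mat_ext; simpl; ring. Qed.

Lemma mapp_mid v : mapp mid v = v.
Proof. destruct v. vec. f_equal; ring. Qed.

Lemma mapp_minv_l m v : SL2 m -> mapp (minv m) (mapp m v) = v.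
Proof. intros H. rewrite <- mapp_mmul, mmul_minv_l, mapp_mid by exact H. reflexivity. Qed.

Lemma mapp_minv_r m v : SL2 m -> mapp m (mapp (minv m) v) = v.
Proof. intros H. rewrite <- mapp_mmul, mmul_minv_r, mapp_mid by exact H. reflexivity. Qed.

Lemma wedge_minv m v w : SL2 m -> wedge (mapp (minv m) v) w = wedge v (mapp m w).
Proof.
  intros H. rewrite <- (wedge_mapp m) by exact H. now rewrite mapp_minv_r.
Qed.

Lemma basis_expansion p q v :
  wedge p q <> 0 -> v = lc (wedge v q / wedge p q) p (wedge p v / wedge p q) q.
Proof. intros H. destruct v. vec. f_equal; field; exact H. Qed.

Lemma mapp_unique m n p q :
  wedge p q <> 0 -> mapp m p = mapp n p -> mapp m q = mapp n q -> m = n.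
Proof.
  intros H Hp Hq.
  assert (K : forall v, mapp m v = mapp n v).
  { intros v. rewrite (basis_expansion p q v H), !mapp_lc, Hp, Hq. reflexivity. }
  pose proof (K (1, 0)) as K1. pose proof (K (0, 1)) as K2. vec.
  injection K1 as K1 K3. injection K2 as K2 K4. apply mat_ext; lra.
Qed.

Lemma vec_unique p q v w :
  wedge p q <> 0 -> wedge p v = wedge p w -> wedge q v = wedge q w -> v = w.
Proof.
  intros H Hp Hq. rewrite (basis_expansion p q v H), (basis_expansion p q w H).
  now rewrite Hp, (wedge_anti v q), (wedge_anti w q), Hq.
Qed.

Lemma linear_extension p q v w :
  wedge p q <> 0 -> wedge v w = wedge p q ->
  exists m, SL2 m /\ mapp m p = v /\ mapp m q = w.
Proof.
  destruct p as [p1 p2], q as [q1 q2], v as [v1 v2], w as [w1 w2]. vec.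
  intros H E.
  exists (Mat ((v1 * q2 - w1 * p2) / (p1 * q2 - p2 * q1))
              ((w1 * p1 - v1 * q1) / (p1 * q2 - p2 * q1))
              ((v2 * q2 - w2 * p2) / (p1 * q2 - p2 * q1))
              ((w2 * p1 - v2 * q1) / (p1 * q2 - p2 * q1))).
  unfold SL2. simpl. split; [|split; f_equal; field; exact H].
  transitivity ((v1 * w2 - v2 * w1) / (p1 * q2 - p2 * q1)); [field; exact H|].
  rewrite E. field. exact H.
Qed.

Definition den (m : mat) (z : pt) : R :=
  (mc m * fst z + md m) ^ 2 + (mc m * snd z) ^ 2.

Lemma den_pos m z : SL2 m -> H2 z -> 0 < den m z.
Proof.
  unfold SL2, H2, den. destruct z as [x y]; simpl. intros H Hy.
  assert (0 <= (mc m * x + md m) * (mc m * x + md m)) by apply Rle_0_sqr.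
  assert (0 <= (mc m * y) * (mc m * y)) by apply Rle_0_sqr.
  destruct (Req_dec (mc m) 0) as [E|E].
  - rewrite E in *. nra.
  - assert (0 < (mc m * y) * (mc m * y)) by (apply Rsqr_pos_lt; apply Rmult_integral_contrapositive_currified; lra).
    nra.
Qed.

Lemma act_eq m z : SL2 m ->
  act m z = (((ma m * fst z + mb m) * (mc m * fst z + md m) + ma m * mc m * snd z ^ 2) / den m z,
             snd z / den m z).
Proof. unfold SL2, act, den. intros H. simpl. rewrite H, Rmult_1_r. reflexivity. Qed.

Lemma H2_act m z : SL2 m -> H2 z -> H2 (act m z).
Proof.
  intros H Hz. unfold H2. rewrite act_eq by exact H. simpl.
  apply Rdiv_lt_0_compat; [exact Hz | now apply den_pos].
Qed.

(** The complex number p1 - z p2 is divided by cz + d when [m] acts on both [p] and [z], and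
    [den m z] is |cz + d|^2. *)
Lemma polar_act m p q z : SL2 m -> H2 z ->
  polar (mapp m p) (mapp m q) (act m z) * den m z = polar p q z.
Proof.
  intros H Hz. pose proof (den_pos m z H Hz) as Hd.
  rewrite act_eq by exact H.
  destruct m as [a b c d], p as [p1 p2], q as [q1 q2], z as [x y].
  unfold SL2 in H. unfold den in *. vec.
  match type of Hd with 0 < ?t => set (D := t) in * end.
  set (N := (a * x + b) * (c * x + d) + a * c * (y * (y * 1))).
  set (P1 := a * p1 + b * p2). set (P2 := c * p1 + d * p2).
  set (Q1 := a * q1 + b * q2). set (Q2 := c * q1 + d * q2).
  transitivity (((P1 * D - N * P2) * (Q1 * D - N * Q2) + y ^ 2 * 1 ^ 2 * P2 * Q2) / D);
    [field; lra|].
  rewrite <- H.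
  transitivity (D * ((p1 - x * p2) * (q1 - x * q2) + y * (y * 1) * p2 * q2)
                * (a * d - b * c) ^ 2 / D).
  - f_equal. unfold D, N, P1, P2, Q1, Q2. ring.
  - rewrite H. field. lra.
Qed.

Lemma polar_pos p z : H2 z -> p <> (0, 0) -> 0 < polar p p z.
Proof.
  destruct p as [p1 p2], z as [x y]. unfold H2. vec. intros Hy Hp.
  destruct (Req_dec p2 0) as [E|E].
  - subst. assert (p1 <> 0) by (intros ->; now apply Hp). nra.
  - assert (0 <= (p1 - x * p2) * (p1 - x * p2)) by apply Rle_0_sqr.
    assert (0 < (y * p2) * (y * p2)) by
      (apply Rsqr_pos_lt; apply Rmult_integral_contrapositive_currified; lra).
    nra.
Qed.

Lemma wedge_nonzero_l p q : wedge p q <> 0 -> p <> (0, 0).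
Proof. intros H ->. apply H. vec. ring. Qed.

Lemma wedge_nonzero_r p q : wedge p q <> 0 -> q <> (0, 0).
Proof. intros H ->. apply H. vec. ring. Qed.

(** Bilinearity in the basis [p], [q], cleared of denominators. For [z] on the line with these ends
    the last term vanishes, so the form at [z] is diagonal. *)
Lemma polar_expand p q v w z :
  wedge p q * wedge p q * polar v w z =
  wedge v q * wedge w q * polar p p z + wedge p v * wedge p w * polar q q z
  + (wedge v q * wedge p w + wedge p v * wedge w q) * polar p q z.
Proof. vec. ring. Qed.

(* [z] is the ratio of the coordinates of the complex vector [tau p + i q], where [tau ^ 2 = t]. *)
Lemma point_on_line p q (t : R) : wedge p q <> 0 -> 0 < t ->
  exists z, H2 z /\ polar p q z = 0 /\ polar q q z = t * polar p p z /\
    0 < t * snd p ^ 2 + snd q ^ 2 /\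
    (t * snd p ^ 2 + snd q ^ 2) * fst z = t * fst p * snd p + fst q * snd q /\
    (t * snd p ^ 2 + snd q ^ 2) * (fst z ^ 2 + snd z ^ 2) = t * fst p ^ 2 + fst q ^ 2.
Proof.
  destruct p as [p1 p2], q as [q1 q2]. intros H Ht. vec.
  set (D := t * (p2 * (p2 * 1)) + q2 * (q2 * 1)).
  set (d := p1 * q2 - p2 * q1) in *.
  assert (HD : 0 < D).
  { unfold D. destruct (Req_dec p2 0) as [E|E].
    - assert (q2 <> 0) by (intros E2; apply H; unfold d; rewrite E, E2; ring). subst p2. nra.
    - assert (0 < p2 * p2) by nra. nra. }
  (* The imaginary part of the ratio is [y / D] up to sign; the absolute value selects the
     representative in the upper half-plane. *)
  set (y := sqrt t * Rabs d).
  assert (Hy2 : y * y = t * (d * d)).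
  { unfold y. replace (sqrt t * Rabs d * (sqrt t * Rabs d))
      with ((sqrt t * sqrt t) * (Rabs d * Rabs d)) by ring.
    rewrite sqrt_sqrt by lra. f_equal.
    pose proof (Rsqr_abs d) as E. unfold Rsqr in E. now rewrite E. }
  assert (Hy : 0 < y).
  { apply Rmult_lt_0_compat; [now apply sqrt_lt_R0 | now apply Rabs_pos_lt]. }
  exists ((t * p1 * p2 + q1 * q2) / D, y / D). unfold H2. simpl.
  split; [now apply Rdiv_lt_0_compat|].
  set (N := t * p1 * p2 + q1 * q2).
  assert (F : forall a1 a2 b1 b2,
    (a1 - N / D * a2) * (b1 - N / D * b2) + y / D * (y / D * 1) * a2 * b2 =
    ((a1 * D - N * a2) * (b1 * D - N * b2) + y * y * a2 * b2) / D ^ 2)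
    by (intros; field; lra).
  rewrite !F, Hy2. repeat split; try fold D.
  - replace (_ + _) with 0 by (unfold D, N, d; ring). field. lra.
  - transitivity ((t * ((p1 * D - N * p2) * (p1 * D - N * p2) + t * (d * d) * p2 * p2)) / D ^ 2).
    + f_equal. unfold D, N, d. ring.
    + field. lra.
  - exact HD.
  - field. lra.
  - transitivity ((N * N + y * y) / D); [field; lra|].
    rewrite Hy2. apply Rmult_eq_reg_r with D; [|lra]. unfold Rdiv.
    rewrite Rmult_assoc, Rinv_l by lra. unfold N, d, D. ring.
Qed.

(** The two equations are the sum and the product of the roots of c z^2 + (d - a) z - b, cleared of
    denominators, for the roots [z] and its conjugate. *)
Lemma act_fixed m z : SL2 m -> H2 z ->
  2 * mc m * fst z = ma m - md m ->
  mc m * (fst z ^ 2 + snd z ^ 2) = - mb m -> act m z = z.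
Proof.
  intros H Hz H1 H2'. rewrite act_eq by exact H.
  assert (E : den m z = 1).
  { unfold den. unfold SL2 in H.
    destruct m as [a b c d], z as [x y]; simpl in *. nsatz. }
  rewrite E, !Rdiv_1_r. unfold SL2 in H. destruct m as [a b c d], z as [x y]; simpl in *.
  f_equal. nsatz.
Qed.

(** * Ideal points, eigenvectors and membership in C(l) *)

Lemma evec_nonzero e : evec e <> (0, 0).
Proof. destruct e; simpl; intros H; injection H; lra. Qed.

Lemma evec_wedge_neq e f : e <> f -> wedge (evec e) (evec f) <> 0.
Proof.
  destruct e, f; vec; intros H E; try lra; apply H; try reflexivity. f_equal. lra.
Qed.

Lemma bpt_of_vec v : v <> (0, 0) -> exists e c, c <> 0 /\ evec e = lc c v 0 v.
Proof.
  destruct v as [v1 v2]. intros H. destruct (Req_dec v2 0) as [->|E].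
  - assert (v1 <> 0) by (intros ->; now apply H).
    exists Inf, (- / v1). split.
    + now apply Ropp_neq_0_compat, Rinv_neq_0_compat.
    + vec. f_equal; field; assumption.
  - exists (Fin (v1 / v2)), (/ v2). split; [now apply Rinv_neq_0_compat|].
    vec. f_equal; field; exact E.
Qed.

(** The scalar multiple is written as a degenerate combination, so that the lemmas on [lc] apply to
    it. *)
Definition eigen (m : mat) (lam : R) (v : R * R) : Prop := mapp m v = lc lam v 0 v.

Lemma eigen_bvec m lam e : eigen m lam (evec e) <->
  ma m * fst (bvec e) + mb m * snd (bvec e) = lam * fst (bvec e) /\
  mc m * fst (bvec e) + md m * snd (bvec e) = lam * snd (bvec e).
Proof.
  unfold eigen. vec. destruct e; simpl; split; [intros H; injection H|intros []; f_equal|intros H; injection H|intros []; f_equal]; lra.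
Qed.

Lemma eigen_act_b m lam e : lam <> 0 -> eigen m lam (evec e) -> act_b m e = e.
Proof.
  intros Hl H. apply eigen_bvec in H. destruct e as [x|]; simpl in *; destruct H as [H1 H2].
  - destruct (Req_EM_T (mc m * x + md m) 0) as [E|E]; [lra|].
    f_equal. apply Rmult_eq_reg_r with (mc m * x + md m); [|exact E].
    unfold Rdiv. rewrite Rmult_assoc, Rinv_l by exact E.
    replace (mc m * x + md m) with lam by lra. lra.
  - destruct (Req_EM_T (mc m) 0) as [E|E]; [reflexivity|lra].
Qed.

Lemma act_b_eigen m e : SL2 m -> act_b m e = e -> exists lam, lam <> 0 /\ eigen m lam (evec e).
Proof.
  intros Hm. destruct e as [x|]; simpl.
  - destruct (Req_EM_T (mc m * x + md m) 0) as [E|E]; [discriminate|].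
    intros H. injection H as H. exists (mc m * x + md m). split; [exact E|].
    apply (eigen_bvec _ _ (Fin x)). simpl. split; [|ring].
    rewrite <- H at 3. field. exact E.
  - destruct (Req_EM_T (mc m) 0) as [E|E]; [|discriminate]. intros _.
    exists (ma m). split.
    + intros Z. unfold SL2 in Hm. rewrite E, Z in Hm. lra.
    + apply (eigen_bvec _ _ Inf). simpl. lra.
Qed.

Lemma eigen_tr m lam v : SL2 m -> v <> (0, 0) -> eigen m lam v -> lam * tr m = lam * lam + 1.
Proof.
  intros Hm Hv H. unfold eigen in H. destruct m as [a b c d], v as [x y]. unfold SL2 in Hm.
  unfold tr. vec. injection H as H1 H2.
  destruct (Req_dec x 0) as [E|E].
  - assert (y <> 0) by (intros ->; subst; now apply Hv).
    apply Rmult_eq_reg_r with y; [|assumption]. nsatz.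
  - apply Rmult_eq_reg_r with x; [|assumption]. nsatz.
Qed.

Lemma Rabs_sqr x : Rabs x * Rabs x = x * x.
Proof. pose proof (Rsqr_abs x) as E. unfold Rsqr in E. now rewrite <- E. Qed.

Lemma hyperbolic_sqr m : hyperbolic m <-> 4 < tr m * tr m.
Proof.
  unfold hyperbolic. rewrite <- Rabs_sqr. pose proof (Rabs_pos (tr m)).
  split; intros; nra.
Qed.

Lemma elliptic_sqr m : elliptic m <-> tr m * tr m < 4.
Proof.
  unfold elliptic. rewrite <- Rabs_sqr. pose proof (Rabs_pos (tr m)).
  split; intros; nra.
Qed.

Lemma abs_eq_2 x : Rabs x = 2 <-> x * x = 4.
Proof.
  rewrite <- Rabs_sqr. pose proof (Rabs_pos x). split; intros; nra.
Qed.

Lemma is_identity_dec m : is_identity m \/ ~ is_identity m.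
Proof.
  unfold is_identity, peq, mid, mopp. simpl. destruct m as [a b c d].
  destruct (Req_dec a 1), (Req_dec b 0), (Req_dec c 0), (Req_dec d 1),
    (Req_dec a (-1)), (Req_dec d (-1)); subst;
    try (left; left; reflexivity); try (left; right; f_equal; ring);
    right; intros [E|E]; injection E; intros; lra.
Qed.

(** Treats the nonrepelling ideal fixed points together: the trace is lam + 1/lam, so lam^2 > 1 is
    the attracting hyperbolic case and lam^2 = 1 leaves the parabolic case and the identity. *)
Lemma Cset_eigen l h e lam : SL2 h -> is_endpoint l e -> 1 <= lam * lam ->
  eigen h lam (evec e) -> Cset l h.
Proof.
  intros Hh He Hl H.
  assert (L0 : lam <> 0) by (intros ->; lra).
  pose proof (eigen_tr _ _ _ Hh (evec_nonzero e) H) as T.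
  assert (T2 : lam * lam * (tr h * tr h) = (lam * lam + 1) * (lam * lam + 1))
    by (rewrite <- T; ring).
  destruct (Rle_lt_or_eq_dec _ _ Hl) as [L|L].
  - right; right; right. split.
    + apply hyperbolic_sqr. nra.
    + exists e. split; [exact He|]. exists lam. split; [exact L|]. now apply eigen_bvec.
  - destruct (is_identity_dec h) as [I|I]; [now left|].
    right; right; left. split.
    + split; [|exact I]. apply abs_eq_2. rewrite <- L in T2. lra.
    + exists e. split; [exact He|]. now apply eigen_act_b with lam.
Qed.

Lemma entries_from_basis h p q a b c d : wedge p q <> 0 ->
  mapp h p = lc a p c q -> mapp h q = lc b p d q ->
  wedge p q * ma h = a * fst p * snd q + c * fst q * snd q - b * fst p * snd p - d * fst q * snd p /\
  wedge p q * mb h = - (a * fst p * fst q + c * fst q * fst q) + b * fst p * fst p + d * fst q * fst p /\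
  wedge p q * mc h = a * snd p * snd q + c * snd q * snd q - b * snd p * snd p - d * snd q * snd p /\
  wedge p q * md h = - (a * snd p * fst q + c * snd q * fst q) + b * snd p * fst p + d * snd q * fst p.
Proof.
  intros H Hp Hq. vec. injection Hp as P1 P2. injection Hq as Q1 Q2.
  repeat split; nsatz.
Qed.

(** For tau^2 = eta / kap the complex vector tau p + i q is an eigenvector of [h], so the point of
    the line that it represents is fixed; the trace is 2 C. *)
Lemma Cset_elliptic l h C kap eta p q :
  SL2 h -> (p = evec (ep1 l) /\ q = evec (ep2 l) \/ p = evec (ep2 l) /\ q = evec (ep1 l)) ->
  0 < kap * eta -> C * C < 1 ->
  mapp h p = lc C p kap q -> mapp h q = lc (- eta) p C q ->
  Cset l h.
Proof.
  intros Hh Hpq Hke HC Hp Hq.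
  assert (W : wedge p q <> 0).
  { pose proof (evec_wedge_neq _ _ (ep_neq l)).
    destruct Hpq as [[-> ->]|[-> ->]]; [assumption|]. rewrite wedge_anti. lra. }
  destruct (entries_from_basis _ _ _ _ _ _ _ W Hp Hq) as [Ea [Eb [Ec Ed]]].
  assert (Hk : kap <> 0) by (intros ->; lra).
  assert (Ht : 0 < eta / kap).
  { apply (sqr_cancel kap). replace (kap * kap * (eta / kap)) with (kap * eta); [exact Hke|].
    field. exact Hk. }
  destruct (point_on_line p q (eta / kap) W Ht) as [z [Hz [Z1 [_ [HD [Z2 Z3]]]]]].
  right; left. split.
  - apply elliptic_sqr. replace (tr h) with (2 * C); [nra|].
    apply Rmult_eq_reg_l with (wedge p q); [|exact W].
    unfold tr. rewrite Rmult_plus_distr_l, Ea, Ed. vec. ring.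
  - exists z. split.
    + split; [exact Hz|]. rewrite gfun_polar.
      destruct Hpq as [[-> ->]|[-> ->]]; [exact Z1|].
      rewrite <- Z1. vec. ring.
    + set (D := eta / kap * snd p ^ 2 + snd q ^ 2) in *.
      assert (Ec' : wedge p q * mc h = kap * D).
      { rewrite Ec. unfold D. field. exact Hk. }
      apply act_fixed; [exact Hh|exact Hz| |];
        apply Rmult_eq_reg_l with (wedge p q); try exact W.
      * transitivity (2 * kap * (D * fst z)).
        { transitivity (2 * (wedge p q * mc h) * fst z); [ring|]. rewrite Ec'. ring. }
        rewrite Z2, Rmult_minus_distr_l, Ea, Ed. field. exact Hk.
      * transitivity (kap * (D * (fst z ^ 2 + snd z ^ 2))).
        { transitivity ((wedge p q * mc h) * (fst z ^ 2 + snd z ^ 2)); [ring|]. rewrite Ec'. ring. }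
        rewrite Z3. transitivity (- (wedge p q * mb h)); [|ring].
        rewrite Eb. field. exact Hk.
Qed.

(** * Disjointness and lengthening *)

(* The lengthening condition [d(x, x') < d(x, k x')] at the ideal points of the
   two lines, distances being read off horoballs: the vectors [evec e] stand for
   horoballs, whose distance is an increasing function of [Rabs (wedge _ _)]. *)
Definition lengthens (k : mat) (l l' : geod) : Prop :=
  forall e e', is_endpoint l e -> is_endpoint l' e' ->
    wedge (evec e) (evec e') ^ 2 < wedge (evec e) (mapp k (evec e')) ^ 2.

Definition line_form (l : geod) (t1 t2 : R) (v : R * R) : R :=
  t1 * wedge (evec (ep1 l)) v ^ 2 + t2 * wedge (evec (ep2 l)) v ^ 2.

Lemma wedge_ep l : wedge (evec (ep1 l)) (evec (ep2 l)) <> 0.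
Proof. apply evec_wedge_neq, ep_neq. Qed.

Lemma act_fixed_den h z : SL2 h -> H2 z -> act h z = z -> den h z = 1.
Proof.
  intros Hh Hz H. pose proof (den_pos h z Hh Hz) as Hd. rewrite act_eq in H by exact Hh.
  destruct z as [x y]. unfold H2 in Hz. simpl in *. injection H as _ H.
  apply Rmult_eq_reg_l with (y / den h (x, y)); [|rewrite H; lra].
  rewrite H at 2. field. lra.
Qed.

Lemma eigen_form h lam v w : SL2 h -> eigen h lam v ->
  wedge v w ^ 2 = lam * lam * wedge v (mapp h w) ^ 2.
Proof.
  intros Hh H. rewrite <- (wedge_mapp h v w Hh), H, wedge_lc_l. ring.
Qed.

(* A point of the closed line is a nonnegative form spanned by its two ideal
   points, and a nonrepelling fixed point is a form which [h] does not expand. *)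
Lemma Cset_form l h : SL2 h -> Cset l h ->
  exists t1 t2 rho, 0 <= t1 /\ 0 <= t2 /\ 0 < t1 + t2 /\ 1 <= rho /\
    forall v, line_form l t1 t2 v = rho * line_form l t1 t2 (mapp h v).
Proof.
  intros Hh.
  assert (K : forall e lam, is_endpoint l e -> 1 <= lam * lam -> eigen h lam (evec e) ->
    exists t1 t2 rho, 0 <= t1 /\ 0 <= t2 /\ 0 < t1 + t2 /\ 1 <= rho /\
    forall v, line_form l t1 t2 v = rho * line_form l t1 t2 (mapp h v)).
  { intros e lam [->| ->] Hl E.
    - exists 1, 0, (lam * lam). repeat split; try lra. intros v. unfold line_form.
      rewrite (eigen_form h lam _ v Hh E). ring.
    - exists 0, 1, (lam * lam). repeat split; try lra. intros v. unfold line_form.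
      rewrite (eigen_form h lam _ v Hh E). ring. }
  intros [I|[[_ [z [[Hz Hl] Hf]]]|[[[Ht _] [e [He Hf]]]|[_ [e [He [lam [Hl Hf]]]]]]]].
  - apply (K (ep1 l) (ma h)).
    + now left.
    + destruct I as [->| ->]; simpl; lra.
    + destruct I as [->| ->]; unfold eigen; vec; f_equal; ring.
  - set (p := evec (ep1 l)). set (q := evec (ep2 l)).
    pose proof (wedge_ep l) as W. fold p q in W.
    rewrite gfun_polar in Hl. fold p q in Hl.
    pose proof (polar_pos p z Hz (wedge_nonzero_l _ _ W)).
    pose proof (polar_pos q z Hz (wedge_nonzero_r _ _ W)).
    (* These are the weights of the diagonal form at [z] given by [polar_expand]. Since [h] fixes
       [z], it preserves this form, and [rho] is 1. *)
    exists (polar q q z), (polar p p z), 1. repeat split; try lra.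
    assert (F : forall v, line_form l (polar q q z) (polar p p z) v
                          = wedge p q * wedge p q * polar v v z).
    { intros v. rewrite polar_expand, Hl. unfold line_form. fold p q.
      rewrite (wedge_anti v q). ring. }
    intros v. rewrite !F. rewrite <- (polar_act h v v z Hh Hz).
    rewrite Hf, (act_fixed_den h z Hh Hz Hf). ring.
  - destruct (act_b_eigen h e Hh Hf) as [lam [_ E]].
    apply (K e lam He); [|exact E].
    pose proof (eigen_tr _ _ _ Hh (evec_nonzero e) E) as T.
    apply abs_eq_2 in Ht.
    assert (T2 : lam * lam * (tr h * tr h) = (lam * lam + 1) * (lam * lam + 1))
      by (rewrite <- T; ring).
    rewrite Ht in T2.
    assert ((lam * lam - 1) * (lam * lam - 1) = 0) by lra. nra.
  - apply (K e lam He); [lra|]. now apply eigen_bvec.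
Qed.

(** Let [A] pair the forms of the two fixed points, and let [B] pair the first with the image of the
    second under [k]. Then h = k h' up to sign gives A = rho rho' B, hence A >= B, whereas
    lengthening gives A < B. *)
Lemma lengthens_disjoint g g' l l' : SL2 g -> SL2 g' ->
  lengthens (mmul (minv g) g') l l' -> crooked_disjoint g l g' l'.
Proof.
  intros Hg Hg'. set (k := mmul (minv g) g'). intros D h h' Hh Hh' C C' E.
  assert (Hk : SL2 k) by (apply SL2_mmul; [now apply SL2_minv | exact Hg']).
  assert (Es : exists s, s * s = 1 /\ forall v, mapp h v = lc s (mapp k (mapp h' v)) 0 v).
  { assert (Ev : forall v, mapp (minv g) (mapp (mmul g h) v) = mapp h v)
      by (intros; rewrite mapp_mmul; now apply mapp_minv_l).
    assert (Ek : forall v, mapp k (mapp h' v) = mapp (minv g) (mapp (mmul g' h') v))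
      by (intros; unfold k; now rewrite !mapp_mmul).
    destruct E as [E|E].
    - exists 1. split; [ring|]. intros v. rewrite <- Ev, Ek, E. vec. f_equal; ring.
    - exists (-1). split; [ring|]. intros v. rewrite <- Ev, Ek, E. vec. f_equal; ring. }
  destruct Es as [s [Hs Es]].
  destruct (Cset_form l h Hh C) as [t1 [t2 [rho [T1 [T2 [T3 [Hr F]]]]]]].
  destruct (Cset_form l' h' Hh' C') as [t1' [t2' [rho' [T1' [T2' [T3' [Hr' F']]]]]]].
  set (p := evec (ep1 l)). set (q := evec (ep2 l)).
  set (p' := evec (ep1 l')). set (q' := evec (ep2 l')).
  assert (Dpp := D _ _ (or_introl eq_refl) (or_introl eq_refl)).
  assert (Dpq := D _ _ (or_introl eq_refl) (or_intror eq_refl)).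
  assert (Dqp := D _ _ (or_intror eq_refl) (or_introl eq_refl)).
  assert (Dqq := D _ _ (or_intror eq_refl) (or_intror eq_refl)).
  fold p q p' q' in Dpp, Dpq, Dqp, Dqq.
  set (S := fun v => t1 * wedge p v ^ 2 + t2 * wedge q v ^ 2).
  set (S' := fun v => t1' * wedge p' v ^ 2 + t2' * wedge q' v ^ 2).
  change (forall v, S v = rho * S (mapp h v)) in F.
  change (forall v, S' v = rho' * S' (mapp h' v)) in F'.
  (* The pairing is rewritten in two steps: [E1] moves [h] to the other side of the area form as the
     inverse of [k h'], and [E2] absorbs [h'] into its invariant form [S']. *)
  assert (E1 : t1' * S p' + t2' * S q' =
    rho * (t1 * S' (mapp (minv h') (mapp (minv k) p)) + t2 * S' (mapp (minv h') (mapp (minv k) q)))).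
  { assert (G : forall e v, wedge e (mapp h v) ^ 2 = wedge v (mapp (minv h') (mapp (minv k) e)) ^ 2).
    { intros e v. rewrite Es, wedge_lc_r.
      rewrite (wedge_anti v), wedge_minv, wedge_minv by assumption.
      replace (s * _ + 0 * _) with (s * wedge e (mapp k (mapp h' v))) by ring.
      transitivity ((s * s) * wedge e (mapp k (mapp h' v)) ^ 2); [ring|]. rewrite Hs. ring. }
    rewrite (F p'), (F q'). unfold S, S'. rewrite !G. ring. }
  assert (E2 : forall e, S' (mapp (minv h') (mapp (minv k) e)) =
    rho' * (t1' * wedge e (mapp k p') ^ 2 + t2' * wedge e (mapp k q') ^ 2)).
  { intros e. rewrite F', mapp_minv_r by exact Hh'. unfold S'.
    rewrite (wedge_anti p'), (wedge_anti q'), !wedge_minv by exact Hk. ring. }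
  rewrite !E2 in E1. unfold S in E1.
  assert (rr : 1 <= rho * rho') by nra.
  set (A := t1 * t1' * wedge p p' ^ 2 + t1 * t2' * wedge p q' ^ 2
            + t2 * t1' * wedge q p' ^ 2 + t2 * t2' * wedge q q' ^ 2).
  set (B := t1 * t1' * wedge p (mapp k p') ^ 2 + t1 * t2' * wedge p (mapp k q') ^ 2
            + t2 * t1' * wedge q (mapp k p') ^ 2 + t2 * t2' * wedge q (mapp k q') ^ 2).
  assert (EAB : A = rho * rho' * B).
  { transitivity (t1' * (t1 * wedge p p' ^ 2 + t2 * wedge q p' ^ 2)
      + t2' * (t1 * wedge p q' ^ 2 + t2 * wedge q q' ^ 2)); [unfold A; ring|].
    rewrite E1. unfold B. ring. }
  assert (B0 : 0 <= B).
  { unfold B. repeat apply Rplus_le_le_0_compat;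
      (apply Rmult_le_pos; [now apply Rmult_le_pos | apply pow2_ge_0]). }
  assert (AB : A < B).
  { assert (L : forall t t' x X, 0 <= t -> 0 <= t' -> x < X -> t * t' * x <= t * t' * X)
      by (intros; apply Rmult_le_compat_l; [now apply Rmult_le_pos | lra]).
    assert (L' : forall t t' x X, 0 < t -> 0 < t' -> x < X -> t * t' * x < t * t' * X)
      by (intros; apply Rmult_lt_compat_l; [now apply Rmult_lt_0_compat | lra]).
    pose proof (L _ _ _ _ T1 T1' Dpp). pose proof (L _ _ _ _ T1 T2' Dpq).
    pose proof (L _ _ _ _ T2 T1' Dqp). pose proof (L _ _ _ _ T2 T2' Dqq).
    unfold A, B.
    (* Each form has a positive weight, so at least one of the four inequalities enters strictly. *)
    destruct T1 as [T1|<-]; [|assert (T2p : 0 < t2) by lra];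
      (destruct T1' as [T1'|<-]; [|assert (T2p' : 0 < t2') by lra]).
    - pose proof (L' _ _ _ _ T1 T1' Dpp). lra.
    - pose proof (L' _ _ _ _ T1 T2p' Dpq). lra.
    - pose proof (L' _ _ _ _ T2p T1' Dqp). lra.
    - pose proof (L' _ _ _ _ T2p T2p' Dqq). lra. }
  nra.
Qed.

Lemma other_endpoint l e : is_endpoint l e -> exists f, is_endpoint l f /\
  (evec e = evec (ep1 l) /\ evec f = evec (ep2 l) \/ evec e = evec (ep2 l) /\ evec f = evec (ep1 l)).
Proof.
  intros [->| ->].
  - exists (ep2 l). split; [now right | now left].
  - exists (ep1 l). split; [now left | now right].
Qed.

Lemma eigen_minv m lam v : SL2 m -> lam <> 0 -> eigen m lam v -> eigen (minv m) (/ lam) v.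
Proof.
  unfold eigen. intros Hm Hl H.
  assert (E : v = lc (/ lam) (mapp m v) 0 v).
  { rewrite H. destruct v. vec. f_equal; field; exact Hl. }
  rewrite E at 1. rewrite mapp_lc, mapp_minv_l by exact Hm. unfold lc. f_equal; ring.
Qed.

Lemma wedge_zero_collinear v w : v <> (0, 0) -> wedge v w = 0 -> exists c, w = lc c v 0 v.
Proof.
  destruct v as [v1 v2], w as [w1 w2]. vec. intros H E.
  destruct (Req_dec v1 0) as [->|N].
  - assert (v2 <> 0) by (intros ->; now apply H).
    exists (w2 / v2). assert (w1 = 0) by nra. subst. f_equal; field; assumption.
  - exists (w1 / v1). f_equal; [field; exact N|].
    apply Rmult_eq_reg_l with v1; [|exact N]. transitivity (v2 * w1); [lra|]. field. exact N.
Qed.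

Lemma Cset_mid l : Cset l mid.
Proof. left. now left. Qed.

(** By contraposition: from an inequality failing at [e], [e'] one builds h in C(l) and h' in C(l')
    with h = k h'. The construction depends on which of the two areas vanish. *)
Lemma disjoint_lengthens g g' l l' : SL2 g -> SL2 g' ->
  crooked_disjoint g l g' l' -> lengthens (mmul (minv g) g') l l'.
Proof.
  intros Hg Hg' D e e' He He'. set (k := mmul (minv g) g').
  assert (Hk : SL2 k) by (apply SL2_mmul; [now apply SL2_minv | exact Hg']).
  assert (D' : forall h h', SL2 h -> SL2 h' -> Cset l h -> Cset l' h' -> h <> mmul k h').
  { intros h h' Hh Hh' C C' ->. apply (D _ _ Hh Hh' C C'). left.
    unfold k. now rewrite <- mmul_assoc, (mmul_assoc g), mmul_minv_r, mmul_mid_l by assumption. }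
  clear D. apply Rnot_le_lt. intros L.
  destruct (Req_dec (wedge (evec e) (mapp k (evec e'))) 0) as [Z|N];
    destruct (Req_dec (wedge (evec e) (evec e')) 0) as [Z'|N'].
  (* Here [e] and [e'] coincide and [k] fixes them. Either [k] or its inverse is nonrepelling there,
     and it is paired with the identity. *)
  - destruct (wedge_zero_collinear (evec e') (mapp k (evec e'))) as [nu E'].
    { apply evec_nonzero. }
    { destruct (wedge_zero_collinear _ _ (evec_nonzero e) Z') as [c Ec].
      rewrite Ec at 1. rewrite wedge_lc_l, Z. ring. }
    change (eigen k nu (evec e')) in E'.
    assert (E : eigen k nu (evec e)).
    { assert (Z2 : wedge (evec e') (evec e) = 0) by (rewrite wedge_anti; lra).
      destruct (wedge_zero_collinear _ _ (evec_nonzero e') Z2) as [c Ec].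
      unfold eigen in *. rewrite Ec, mapp_lc, E'. vec. f_equal; ring. }
    pose proof (eigen_tr _ _ _ Hk (evec_nonzero e) E) as T.
    assert (N : nu <> 0) by (intros ->; lra).
    destruct (Rle_lt_dec 1 (nu * nu)) as [G|G].
    + apply (D' k mid Hk SL2_mid); [now apply Cset_eigen with e nu | apply Cset_mid |].
      now rewrite mmul_mid_r.
    + apply (D' mid (minv k) SL2_mid (SL2_minv k Hk)); [apply Cset_mid | |].
      * apply Cset_eigen with e' (/ nu); [now apply SL2_minv | exact He' | | now apply eigen_minv].
        rewrite <- Rinv_mult, <- Rinv_1. apply Rinv_le_contravar; nra.
      * now rewrite mmul_minv_r.
  (* Here [k] sends [e'] to [e], and the two are distinct. *)
  - destruct (other_endpoint l' e' He') as [f' [Hf' Hef]].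
    destruct (wedge_zero_collinear _ _ (evec_nonzero e) Z) as [c Ec].
    set (u := evec e) in *. set (p := evec e') in *. set (q := evec f') in *.
    assert (W : wedge p q <> 0).
    { pose proof (wedge_ep l').
      destruct Hef as [[-> ->]|[-> ->]]; [assumption|]. rewrite wedge_anti. lra. }
    set (alpha := wedge u q / wedge p q). set (beta := wedge p u / wedge p q).
    assert (Eu : u = lc alpha p beta q) by now apply basis_expansion.
    assert (Hb : beta <> 0).
    { unfold beta. rewrite (wedge_anti p u). intros E. apply N'.
      apply (Rmult_eq_compat_r (wedge p q)) in E. field_simplify in E; [lra|exact W]. }
    assert (Hc : c <> 0).
    { intros ->. apply W. rewrite <- (wedge_mapp k) by exact Hk. rewrite Ec. vec. ring. }
    (* [h'] is the rotation about a point of [l'] for which [k h'] fixes [e];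
       placing its centre close enough to [e'] makes [e] nonrepelling. *)
    set (M := sqrt (1 + (alpha * c) * (alpha * c))).
    assert (HM2 : M * M = 1 + (alpha * c) * (alpha * c)) by (apply sqrt_sqrt; nra).
    assert (HM : 0 < M) by (apply sqrt_lt_R0; nra).
    (* Asking the inverse of [h'] to send [p] to c/M times [u] gives [C] and [kap]. Determinant 1
       then gives [eta], the choice of [M] making kap eta = 1/M^2. The eigenvalue of [k h'] at [e]
       is [M]. *)
    set (C := alpha * c / M). set (kap := - (c * beta) / M). set (eta := - / (M * (c * beta))).
    assert (Hke : kap * eta = 1 / (M * M)).
    { unfold kap, eta. field. repeat split; lra || assumption. }
    assert (HCC : C * C + kap * eta = 1).
    { rewrite Hke. unfold C. transitivity ((1 + (alpha * c) * (alpha * c)) / (M * M)).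
      - field. lra.
      - rewrite HM2. field. nra. }
    assert (Hke0 : 0 < kap * eta) by (rewrite Hke; apply Rdiv_lt_0_compat; nra).
    destruct (linear_extension p q (lc C p kap q) (lc (- eta) p C q) W) as [h' [Hh' [E1 E2]]].
    { rewrite wedge_lc_l, !wedge_lc_r, !wedge_self, (wedge_anti q p).
      transitivity ((C * C + kap * eta) * wedge p q); [ring|]. rewrite HCC. ring. }
    apply (D' (mmul k h') h').
    + now apply SL2_mmul.
    + exact Hh'.
    + apply Cset_eigen with e M; try assumption; [now apply SL2_mmul | nra |].
      assert (Eh : mapp h' u = lc (M / c) p 0 p).
      { rewrite Eu, mapp_lc, E1, E2.
        assert (A1 : alpha * C + beta * - eta = M / c).
        { unfold C, eta. transitivity ((1 + (alpha * c) * (alpha * c)) / (M * c)).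
          - field. repeat split; lra || assumption.
          - rewrite <- HM2. field. split; lra || assumption. }
        assert (A2 : alpha * kap + beta * C = 0).
        { unfold C, kap. field. lra. }
        transitivity (lc (alpha * C + beta * - eta) p (alpha * kap + beta * C) q).
        - vec. f_equal; ring.
        - rewrite A1, A2. vec. f_equal; ring. }
      unfold eigen. fold u. rewrite mapp_mmul, Eh, mapp_lc, Ec. vec. f_equal; field; exact Hc.
    + apply (Cset_elliptic l' h' C kap eta p q); try assumption. lra.
    + reflexivity.
  - exfalso. rewrite Z' in L. assert (0 < wedge (evec e) (mapp k (evec e')) * wedge (evec e) (mapp k (evec e'))) by nra. nra.
  (* Generic case: [h] fixes the vector of [e] and sends that of [e'] to [mu] times its image under
     [k]. The value of [mu] makes [h] area preserving, and the failed inequality says mu^2 >= 1, so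
     the inverse of [k] times [h] is nonrepelling at [e']. *)
  - set (mu := wedge (evec e) (evec e') / wedge (evec e) (mapp k (evec e'))).
    destruct (linear_extension (evec e) (evec e') (evec e) (lc mu (mapp k (evec e')) 0 (evec e)) N')
      as [h [Hh [E1 E2]]].
    { rewrite wedge_lc_r. unfold mu. field. exact N. }
    apply (D' h (mmul (minv k) h)).
    + exact Hh.
    + apply SL2_mmul; [now apply SL2_minv | exact Hh].
    + apply Cset_eigen with e 1; try assumption; try lra.
      unfold eigen. rewrite E1. vec. destruct e; simpl; f_equal; ring.
    + apply Cset_eigen with e' mu; try assumption.
      * apply SL2_mmul; [now apply SL2_minv | exact Hh].
      * unfold mu. set (X := wedge (evec e) (mapp k (evec e'))) in *.
        set (x := wedge (evec e) (evec e')) in *.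
        replace (x / X * (x / X)) with (x ^ 2 * / X ^ 2) by (field; exact N).
        apply Rmult_le_reg_r with (X ^ 2); [nra|].
        rewrite Rmult_assoc, Rinv_l by nra. lra.
      * unfold eigen. rewrite mapp_mmul, E2, mapp_lc, mapp_minv_l by exact Hk. vec. f_equal; ring.
    + now rewrite mmul_assoc, mmul_minv_r, mmul_mid_l.
Qed.

(** * Stem quadrants *)

Definition signed (s : bool) (x : R) : R := if s then x else - x.

Lemma signed_negb s x : signed (negb s) x = - signed s x.
Proof. destruct s; simpl; ring. Qed.

Lemma pos_side_signed l s z : pos_side l s z <->
  H2 z /\ 0 < signed s (polar (evec (ep1 l)) (evec (ep2 l)) z).
Proof. unfold pos_side. rewrite gfun_polar. destruct s; simpl; intuition lra. Qed.

(** At a common point, orthogonality becomes a condition on ideal points alone: the two pairs of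
    ends are harmonic. *)
Lemma ggrad_dot p q P Q z : p <> q -> P <> Q ->
  polar (evec p) (evec q) z = 0 -> polar (evec P) (evec Q) z = 0 ->
  fst (ggrad P Q z) * fst (ggrad p q z) + snd (ggrad P Q z) * snd (ggrad p q z) =
  - (wedge (evec P) (evec p) * wedge (evec Q) (evec q)
     + wedge (evec P) (evec q) * wedge (evec Q) (evec p)).
Proof.
  intros N1 N2 H1 H2.
  assert (F : forall p q, p <> q -> ggrad p q z =
    (- (snd (evec p) * (fst (evec q) - fst z * snd (evec q))
        + snd (evec q) * (fst (evec p) - fst z * snd (evec p))),
     2 * snd z * snd (evec p) * snd (evec q))).
  { intros [x|] [y|] N; simpl; try (now elim N); f_equal; ring. }
  rewrite (F p q N1), (F P Q N2). simpl.
  set (u := evec p) in *. set (v := evec q) in *. set (U := evec P) in *. set (V := evec Q) in *.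
  transitivity (- (wedge U u * wedge V v + wedge U v * wedge V u)
    + 2 * snd U * snd V * polar u v z + 2 * snd u * snd v * polar U V z).
  - vec. ring.
  - rewrite H1, H2. ring.
Qed.

(* [m] acts on the line with ideal points [p], [q] as an element of the stem
   quadrant: its matrix in the basis [(p, q)] is [[a, b], [c, a]] with [bc > 0]. *)
Definition translation (p q : R * R) (m : mat) (a b c : R) : Prop :=
  mapp m p = lc a p c q /\ mapp m q = lc b p a q /\ a * a - b * c = 1 /\ 0 < b * c.

Lemma polar_translation p q m a b c z : SL2 m -> H2 z -> translation p q m a b c ->
  polar p q z = 0 ->
  polar p q (act m z) * den m z = - ((a * b) * polar p p z + (a * c) * polar q q z).
Proof.
  intros Hm Hz [Ep [Eq [Hd _]]] H.
  (* Writing [p] and [q] as images under [m], by the inverse matrix in the basis, makes [polar_act]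
     applicable. *)
  assert (Fp : mapp m (lc a p (- c) q) = p).
  { rewrite mapp_lc, Ep, Eq. transitivity (lc (a * a - b * c) p 0 q).
    - vec. f_equal; ring.
    - rewrite Hd. destruct p. vec. f_equal; ring. }
  assert (Fq : mapp m (lc (- b) p a q) = q).
  { rewrite mapp_lc, Ep, Eq. transitivity (lc 0 p (a * a - b * c) q).
    - vec. f_equal; ring.
    - rewrite Hd. destruct q. vec. f_equal; ring. }
  transitivity (polar (mapp m (lc a p (- c) q)) (mapp m (lc (- b) p a q)) (act m z) * den m z);
    [now rewrite Fp, Fq|].
  rewrite polar_act by assumption.
  transitivity (- ((a * b) * polar p p z + (a * c) * polar q q z)
                + (a * a + b * c) * polar p q z).
  - vec. ring.
  - rewrite H. ring.
Qed.

(** Since bc > 0, [a * b] and [a * c] have the same sign, so by [polar_translation] the defining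
    function at the image point has the sign opposite to [a * c]. *)
Lemma translation_side l s m a b c z : SL2 m -> on l z ->
  translation (evec (ep1 l)) (evec (ep2 l)) m a b c ->
  (pos_side l s (act m z) <-> signed s (a * c) < 0).
Proof.
  intros Hm [Hz Hl] T. rewrite gfun_polar in Hl.
  set (p := evec (ep1 l)) in *. set (q := evec (ep2 l)) in *.
  pose proof (wedge_ep l) as W. fold p q in W.
  pose proof (polar_pos p z Hz (wedge_nonzero_l _ _ W)) as Pp.
  pose proof (polar_pos q z Hz (wedge_nonzero_r _ _ W)) as Pq.
  pose proof (polar_translation p q m a b c z Hm Hz T Hl) as F.
  pose proof (den_pos m z Hm Hz) as Hd.
  destruct T as [_ [_ [Ha Hbc]]].
  assert (S : 0 < (a * b) * (a * c)).
  { replace (a * b * (a * c)) with ((a * a) * (b * c)) by ring. apply Rmult_lt_0_compat; lra. }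
  assert (K : 0 < - (a * c) * (polar p q (act m z) * den m z)).
  { rewrite F. replace (- (a * c) * - _) with
      ((a * b) * (a * c) * polar p p z + (a * c) * (a * c) * polar q q z) by ring.
    apply Rplus_lt_le_0_compat; [now apply Rmult_lt_0_compat|].
    apply Rmult_le_pos; [apply Rle_0_sqr | lra]. }
  assert (K' : 0 < - (a * c) * polar p q (act m z)).
  { apply mul_pos_cancel with (den m z); [exact Hd|]. lra. }
  rewrite pos_side_signed. fold p q.
  split.
  - intros [_ G]. destruct s; simpl in *; nra.
  - intros G. split; [now apply H2_act|]. destruct s; simpl in *; nra.
Qed.

(** With n^2 = c/b the vectors p + n q and p - n q are eigenvectors, of eigenvalues a + b n and a -
    b n. They are the ends of the axis, which meets the line at the parameter b/c of
    [point_on_line]. *)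
Lemma SQ_intro l s m a b c : SL2 m ->
  translation (evec (ep1 l)) (evec (ep2 l)) m a b c -> signed s (a * c) < 0 -> SQ l s m.
Proof.
  intros Hm T Hs. pose proof T as [Ep [Eq [Ha Hbc]]].
  pose proof (wedge_ep l) as W.
  set (p := evec (ep1 l)) in *. set (q := evec (ep2 l)) in *.
  destruct (entries_from_basis _ _ _ _ _ _ _ W Ep Eq) as [Ea [_ [_ Ed]]].
  split.
  { apply hyperbolic_sqr. replace (tr m) with (2 * a); [nra|].
    apply Rmult_eq_reg_l with (wedge p q); [|exact W].
    unfold tr. rewrite Rmult_plus_distr_l, Ea, Ed. vec. ring. }
  assert (Hb : b <> 0) by (intros ->; lra).
  assert (Hc : c <> 0) by (intros ->; lra).
  assert (Hcb : 0 < c / b).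
  { apply (sqr_cancel b). replace (b * b * (c / b)) with (b * c); [exact Hbc|]. field. exact Hb. }
  set (n := sqrt (c / b)).
  assert (Hn : 0 < n) by now apply sqrt_lt_R0.
  assert (Hn2 : n * n = c / b) by (apply sqrt_sqrt; lra).
  assert (Hc2 : c = b * (n * n)) by (rewrite Hn2; field; exact Hb).
  assert (Fix : forall r, r * r = n * n ->
    exists e k, k <> 0 /\ evec e = lc k p (k * r) q /\ act_b m e = e).
  { intros r Hr.
    destruct (bpt_of_vec (lc 1 p r q)) as [e [k [Hk E]]].
    { intros Z. apply W. replace (wedge p q) with (wedge (lc 1 p r q) q) by (rewrite wedge_lc_l, wedge_self; ring).
      rewrite Z. vec. ring. }
    exists e, k. split; [exact Hk|].
    assert (E' : evec e = lc k p (k * r) q) by (rewrite E; vec; f_equal; ring).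
    split; [exact E'|]. apply eigen_act_b with (a + b * r).
    - intros Z. assert ((a + b * r) * (a - b * r) = 1).
      { rewrite <- Ha, Hc2, <- Hr. ring. }
      rewrite Z in H. lra.
    - unfold eigen. rewrite E', mapp_lc, Ep, Eq, Hc2, <- Hr. vec. f_equal; ring. }
  destruct (Fix n) as [P [k1 [Hk1 [EP FP]]]]; [reflexivity|].
  destruct (Fix (- n)) as [Q [k2 [Hk2 [EQ FQ]]]]; [ring|].
  assert (N : P <> Q).
  { intros ->. assert (Z : wedge (evec Q) (evec Q) <> 0).
    { rewrite EP at 1. rewrite EQ. rewrite wedge_lc_l, !wedge_lc_r, !wedge_self, (wedge_anti q p).
      replace (_ + _) with (- (2 * (k1 * k2 * n * wedge p q))) by ring.
      apply Ropp_neq_0_compat.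
      assert (n <> 0) by lra.
      apply Rmult_integral_contrapositive_currified; [lra|].
      repeat (apply Rmult_integral_contrapositive_currified; [|assumption]); assumption. }
    apply Z, wedge_self. }
  destruct (point_on_line p q (b / c) W) as [z [Hz [Z1 [Z2 _]]]].
  { apply (sqr_cancel c). replace (c * c * (b / c)) with (b * c); [exact Hbc|]. field. exact Hc. }
  assert (Hl : on l z) by (split; [exact Hz | now rewrite gfun_polar]).
  assert (HPQ : polar (evec P) (evec Q) z = 0).
  { rewrite EP, EQ. transitivity (k1 * k2 * (polar p p z - (n * n) * polar q q z)).
    - vec. ring.
    - rewrite Z2, Hn2. field. now split. }
  exists P, Q. repeat split; try assumption.
  exists z. split; [split; [exact Hz | now rewrite gfun_polar]|].
  split; [exact Hl|]. split.
  - rewrite ggrad_dot; try assumption; [|apply ep_neq]. fold p q.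
    rewrite EP, EQ, !wedge_lc_l, !wedge_self, (wedge_anti q p). ring.
  - now apply (translation_side l s m a b c z Hm Hl T).
Qed.

(** The ends of the axis form an eigenbasis, and their harmonicity with [p], [q] makes the two
    diagonal entries of [m] in the basis (p, q) equal. Hyperbolicity then gives bc = a^2 - 1 > 0. *)
Lemma SQ_elim l s m : SL2 m -> SQ l s m -> exists a b c,
  translation (evec (ep1 l)) (evec (ep2 l)) m a b c /\ signed s (a * c) < 0.
Proof.
  intros Hm [Hh [P [Q [N [FP [FQ [z [[Hz Hz1] [Hl [Ho Hs]]]]]]]]]].
  pose proof (wedge_ep l) as W. pose proof Hl as [_ Hz2].
  rewrite gfun_polar in Hz1, Hz2.
  rewrite ggrad_dot in Ho; try assumption; [|apply ep_neq].
  set (p := evec (ep1 l)) in *. set (q := evec (ep2 l)) in *.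
  destruct (act_b_eigen m P Hm FP) as [lam [_ EP]].
  destruct (act_b_eigen m Q Hm FQ) as [mu [_ EQ]].
  pose proof (evec_wedge_neq P Q N) as D.
  set (u := evec P) in *. set (v := evec Q) in *.
  set (a := wedge (mapp m p) q / wedge p q).
  assert (Ea : wedge (mapp m p) q = wedge p (mapp m q)).
  { assert (F : forall w, wedge u v * fst (mapp m w) = lam * wedge w v * fst u + mu * wedge u w * fst v /\
                          wedge u v * snd (mapp m w) = lam * wedge w v * snd u + mu * wedge u w * snd v).
    { intros w. rewrite (basis_expansion u v w D), mapp_lc, EP, EQ.
      rewrite !wedge_lc_l, !wedge_lc_r, !wedge_self. vec.
      split; field; exact D. }
    apply Rmult_eq_reg_l with (wedge u v); [|exact D].
    destruct (F p) as [P1 P2], (F q) as [Q1 Q2].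
    transitivity ((wedge u v * fst (mapp m p)) * snd q - (wedge u v * snd (mapp m p)) * fst q);
      [unfold wedge; ring|].
    transitivity (fst p * (wedge u v * snd (mapp m q)) - snd p * (wedge u v * fst (mapp m q)));
      [|unfold wedge; ring].
    rewrite P1, P2, Q1, Q2.
    transitivity (lam * wedge p v * wedge u q + mu * wedge u p * wedge v q); [unfold wedge; ring|].
    transitivity (lam * wedge q v * wedge p u + mu * wedge u q * wedge p v); [|unfold wedge; ring].
    rewrite (wedge_anti p v), (wedge_anti q v), (wedge_anti p u).
    apply Rminus_diag_uniq.
    (* The difference of the diagonal entries, up to a nonzero factor, is a multiple of the harmonic
       expression, which [Ho] annihilates. *)
    transitivity ((lam - mu) * - (wedge u p * wedge v q + wedge u q * wedge v p)); [ring|].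
    rewrite Ho. ring. }
  set (b := wedge (mapp m q) q / wedge p q). set (c := wedge p (mapp m p) / wedge p q).
  assert (Ep : mapp m p = lc a p c q) by now apply basis_expansion.
  assert (Eq : mapp m q = lc b p a q).
  { unfold a. rewrite Ea. now apply basis_expansion. }
  assert (Hd : a * a - b * c = 1).
  { apply Rmult_eq_reg_r with (wedge p q); [|exact W].
    transitivity (wedge (mapp m p) (mapp m q)); [|rewrite wedge_mapp by exact Hm; ring].
    rewrite Ep, Eq. unfold wedge. simpl. ring. }
  destruct (entries_from_basis _ _ _ _ _ _ _ W Ep Eq) as [Ma [_ [_ Md]]].
  assert (Ht : tr m = 2 * a).
  { apply Rmult_eq_reg_l with (wedge p q); [|exact W].
    unfold tr. rewrite Rmult_plus_distr_l, Ma, Md. unfold wedge. ring. }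
  apply hyperbolic_sqr in Hh. rewrite Ht in Hh.
  assert (T : translation p q m a b c) by (repeat split; try assumption; lra).
  exists a, b, c. split; [exact T|].
  now apply (translation_side l s m a b c z Hm Hl T).
Qed.

(** * Points as quadratic forms, the group action, and sides of a line *)

Lemma point_ext z w (r s : R) : H2 z -> H2 w -> 0 < r ->
  (forall v, polar v v z * r = polar v v w * s) -> z = w.
Proof.
  destruct z as [x y], w as [x' y']. unfold H2. simpl. intros Hy Hy' Hr H.
  pose proof (H (1, 0)) as A. pose proof (H (0, 1)) as B. pose proof (H (1, 1)) as C. vec.
  assert (s = r) by lra. subst s.
  assert (B' : x * x + y * y = x' * x' + y' * y') by (apply Rmult_eq_reg_r with r; lra).
  assert (C' : (1 - x) * (1 - x) + y * y = (1 - x') * (1 - x') + y' * y')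
    by (apply Rmult_eq_reg_r with r; lra).
  assert (x = x') by lra. subst x'. f_equal. nra.
Qed.

(** Both points carry the same quadratic form up to scale, by [polar_act]; this avoids composing the
    rational formulas. *)
Lemma act_mmul m n z : SL2 m -> SL2 n -> H2 z -> act m (act n z) = act (mmul m n) z.
Proof.
  intros Hm Hn Hz.
  pose proof (H2_act n z Hn Hz) as Hnz.
  pose proof (SL2_mmul m n Hm Hn) as Hmn.
  apply point_ext with (den m (act n z) * den n z) (den (mmul m n) z).
  - now apply H2_act.
  - now apply H2_act.
  - apply Rmult_lt_0_compat; now apply den_pos.
  - intros v. rewrite <- Rmult_assoc.
    assert (E : v = mapp m (mapp n (mapp (minv n) (mapp (minv m) v))))
      by (now rewrite !mapp_minv_r).
    rewrite E. set (w := mapp (minv n) (mapp (minv m) v)).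
    rewrite polar_act, polar_act by assumption.
    rewrite <- mapp_mmul, polar_act by assumption. reflexivity.
Qed.

Lemma act_mid z : H2 z -> act mid z = z.
Proof. intros Hz. apply act_fixed; [exact SL2_mid | exact Hz | |]; simpl; ring. Qed.

Lemma act_inj m z w : SL2 m -> H2 z -> H2 w -> act m z = act m w -> z = w.
Proof.
  intros Hm Hz Hw E. rewrite <- (act_mid z Hz), <- (act_mid w Hw), <- (mmul_minv_l m Hm).
  rewrite <- !act_mmul by (try assumption; now apply SL2_minv). now rewrite E.
Qed.

Lemma minv_minv m : minv (minv m) = m.
Proof. apply mat_ext; simpl; ring. Qed.

Lemma polar_preimage p q v w m z : SL2 m -> H2 z -> polar p q z = 0 ->
  wedge p q * wedge p q * (polar v w (act (minv m) z) * den (minv m) z) =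
  wedge q (mapp m v) * wedge q (mapp m w) * polar p p z
  + wedge p (mapp m v) * wedge p (mapp m w) * polar q q z.
Proof.
  intros Hm Hz H.
  rewrite <- (mapp_minv_l m v Hm) at 1. rewrite <- (mapp_minv_l m w Hm) at 1.
  rewrite polar_act by (try assumption; now apply SL2_minv).
  rewrite polar_expand, H. unfold wedge. ring.
Qed.

(** By [polar_preimage] the defining function of [l'] at the preimage of [z] is, up to a positive
    factor, a positive combination of the two products. *)
Lemma preimage_side l l' m s z : SL2 m -> on l z ->
  let X e e' := wedge (evec e) (mapp m (evec e')) in
  signed s (X (ep1 l) (ep1 l') * X (ep1 l) (ep2 l')) < 0 ->
  signed s (X (ep2 l) (ep1 l') * X (ep2 l) (ep2 l')) < 0 ->
  neg_side l' s (act (minv m) z).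
Proof.
  intros Hm [Hz Hl] X H1 H3. rewrite gfun_polar in Hl.
  pose proof (SL2_minv m Hm) as Hm'.
  pose proof (polar_preimage _ _ (evec (ep1 l')) (evec (ep2 l')) m z Hm Hz Hl) as E.
  pose proof (wedge_ep l) as W.
  pose proof (polar_pos _ z Hz (wedge_nonzero_l _ _ W)) as Pp.
  pose proof (polar_pos _ z Hz (wedge_nonzero_r _ _ W)) as Pq.
  pose proof (den_pos _ z Hm' Hz) as Hd.
  unfold neg_side. apply pos_side_signed. split; [now apply H2_act|].
  rewrite signed_negb.
  set (Y := polar (evec (ep1 l')) (evec (ep2 l')) (act (minv m) z)) in *.
  apply (sqr_cancel (wedge (evec (ep1 l)) (evec (ep2 l)))).
  apply mul_pos_cancel with (den (minv m) z); [exact Hd|].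
  apply (f_equal (signed s)) in E.
  match goal with |- 0 < ?t => replace t with (- signed s
    (wedge (evec (ep1 l)) (evec (ep2 l)) * wedge (evec (ep1 l)) (evec (ep2 l))
      * (Y * den (minv m) z))) by (destruct s; simpl; ring) end.
  rewrite E. unfold X in *. destruct s; simpl in *; nra.
Qed.

(** * From lengthening to condition (B) *)

Lemma wedge_det p q u v :
  wedge p u * wedge q v - wedge p v * wedge q u = wedge p q * wedge u v.
Proof. unfold wedge. ring. Qed.

(** Otherwise |A - B| = |A| + |B| > |a| + |b| >= |a - b|. *)
Lemma lengthens_same_sign (a b A B : R) :
  a * a < A * A -> b * b < B * B -> A - B = a - b -> 0 < A * B.
Proof.
  intros Ha Hb E. apply Rnot_le_lt. intros L.
  assert (K : - (a * b) <= - (A * B)).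
  { apply Rsqr_incr_0_var; [|lra]. unfold Rsqr.
    replace (- (a * b) * - (a * b)) with ((a * a) * (b * b)) by ring.
    replace (- (A * B) * - (A * B)) with ((A * A) * (B * B)) by ring.
    apply Rmult_le_compat; nra. }
  assert ((A - B) * (A - B) = (a - b) * (a - b)) by now rewrite E.
  nra.
Qed.

Lemma choose_side x : x <> 0 -> exists s, signed s x < 0.
Proof.
  intros H. destruct (Rlt_le_dec 0 x).
  - exists false. simpl. lra.
  - exists true. simpl. lra.
Qed.

Lemma signed_same s x y : signed s x < 0 -> 0 < x * y -> signed s y < 0.
Proof. destruct s; simpl; intros; nra. Qed.

Lemma exists_translation p q a b c : wedge p q <> 0 -> a * a - b * c = 1 -> 0 < b * c ->
  exists m, SL2 m /\ translation p q m a b c.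
Proof.
  intros W H Hbc.
  destruct (linear_extension p q (lc a p c q) (lc b p a q) W) as [m [Hm [E1 E2]]].
  - transitivity ((a * a - b * c) * wedge p q); [vec; ring|]. rewrite H. ring.
  - exists m. now repeat split.
Qed.

Lemma lengthens_condB g g' l l' : SL2 g -> SL2 g' ->
  lengthens (mmul (minv g) g') l l' -> condB l l' g g'.
Proof.
  intros Hg Hg' D. set (k := mmul (minv g) g') in *.
  assert (Hk : SL2 k) by (apply SL2_mmul; [now apply SL2_minv | exact Hg']).
  assert (Egk : mmul g k = g').
  { unfold k. now rewrite mmul_assoc, mmul_minv_r, mmul_mid_l. }
  assert (H11 := D _ _ (or_introl eq_refl) (or_introl eq_refl)).
  assert (H12 := D _ _ (or_introl eq_refl) (or_intror eq_refl)).
  assert (H21 := D _ _ (or_intror eq_refl) (or_introl eq_refl)).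
  assert (H22 := D _ _ (or_intror eq_refl) (or_intror eq_refl)).
  pose proof (wedge_ep l) as W. pose proof (wedge_ep l') as W'.
  set (p := evec (ep1 l)) in *. set (q := evec (ep2 l)) in *.
  set (p' := evec (ep1 l')) in *. set (q' := evec (ep2 l')) in *.
  set (X11 := wedge p (mapp k p')) in *. set (X12 := wedge p (mapp k q')) in *.
  set (X21 := wedge q (mapp k p')) in *. set (X22 := wedge q (mapp k q')) in *.
  set (x11 := wedge p p') in *. set (x12 := wedge p q') in *.
  set (x21 := wedge q p') in *. set (x22 := wedge q q') in *.
  assert (Hd : X11 * X22 - X12 * X21 = x11 * x22 - x12 * x21).
  { unfold X11, X12, X21, X22, x11, x12, x21, x22. rewrite !wedge_det.
    now rewrite wedge_mapp. }
  assert (Hd0 : x11 * x22 - x12 * x21 <> 0).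
  { unfold x11, x12, x21, x22. rewrite wedge_det.
    now apply Rmult_integral_contrapositive_currified. }
  assert (M : forall x y X Y, x ^ 2 < X ^ 2 -> y ^ 2 < Y ^ 2 -> (x * y) * (x * y) < (X * Y) * (X * Y)).
  { intros x y X Y H1 H3.
    replace (x * y * (x * y)) with (x ^ 2 * y ^ 2) by ring.
    replace (X * Y * (X * Y)) with (X ^ 2 * Y ^ 2) by ring.
    apply Rmult_le_0_lt_compat; try assumption; apply pow2_ge_0. }
  assert (HX : 0 < (X11 * X22) * (X12 * X21)).
  { now apply (lengthens_same_sign (x11 * x22) (x12 * x21)); [apply M | apply M |]. }
  destruct (factor_translations x11 x12 x21 x22 X11 X12 X21 X22)
    as [s [a [b [c [a' [b' [c' [Hs [Ha [Ha' [Hbc [Hbc' [S [S' [E11 [E12 [E21 E22]]]]]]]]]]]]]]]]];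
    try assumption; try lra.
  destruct (exists_translation p q a b c W Ha Hbc) as [u [Hu Tu]].
  destruct (exists_translation p' q' a' b' c' W' Ha' Hbc') as [v [Hv Tv]].
  (* The sign of [X11 * X21] tells on which side of [l] the image of [p'] under [k] lies, and [r]
     makes that side negative. By [HX] the image of [q'] lies on the same side; [r'] is obtained
     likewise with the lines exchanged. *)
  destruct (choose_side (X11 * X21)) as [r Hr]; [intros Z; rewrite Z in S; lra|].
  destruct (choose_side (X11 * X12)) as [r' Hr']; [intros Z; rewrite Z in S'; lra|].
  assert (Hr2 : signed r (X12 * X22) < 0) by (apply (signed_same _ _ _ Hr); lra).
  assert (Hr2' : signed r' (X21 * X22) < 0) by (apply (signed_same _ _ _ Hr'); lra).
  assert (Aw : img_away g l r g' l' r').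
  { split.
    - intros w Hw. exists (act k w). split.
      + rewrite <- (minv_minv k).
        apply (preimage_side l' l (minv k) r w); [now apply SL2_minv | exact Hw | |];
          fold p q p' q'; rewrite !(wedge_anti _ (mapp _ _)), !wedge_minv by exact Hk;
          fold X11 X12 X21 X22; rewrite Rmult_opp_opp; assumption.
      + destruct Hw as [Hw _]. rewrite act_mmul by assumption. now rewrite Egk.
    - intros z Hz. exists (act (minv k) z). split.
      + now apply (preimage_side l l' k r' z).
      + destruct Hz as [Hz _]. rewrite act_mmul by (try assumption; now apply SL2_minv).
        f_equal. rewrite <- Egk, <- mmul_assoc, mmul_minv_r by exact Hk. apply mmul_mid_r. }
  split; [|exists r, r'; split; [exact Aw|]].
  - intros z w Hz Hw E. destruct Aw as [Aw _]. destruct (Aw w Hw) as [z' [Hz' E']].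
    destruct Hz as [Hz Hz0]. rewrite <- E in E'.
    apply act_inj in E'; [|exact Hg | apply Hz' | exact Hz]. subst z'.
    apply pos_side_signed in Hz'. rewrite gfun_polar in Hz0. rewrite Hz0 in Hz'.
    destruct Hz' as [_ Hz']. destruct r; simpl in Hz'; lra.
  - exists u, v. split; [exact Hu|]. split; [exact Hv|].
    split; [apply (SQ_intro l r u a b c Hu Tu); apply (signed_same _ _ _ Hr); lra|].
    split; [apply (SQ_intro l' r' v a' b' c' Hv Tv); apply (signed_same _ _ _ Hr'); lra|].
    fold k.
    destruct Tu as [Up [Uq _]], Tv as [Vp [Vq _]].
    (* Pairing with [p] and [q] reduces this to the four equations of the factorisation; [s] becomes
       the sign ambiguity of [peq]. *)
    assert (F : forall w, w = p' \/ w = q' ->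
      mapp k w = lc s (mapp (mmul (minv u) v) w) 0 (0, 0)).
    { intros w Hw. apply (vec_unique p q); [exact W | |];
      rewrite wedge_lc_r, mapp_mmul, (wedge_anti _ (mapp (minv u) _)), wedge_minv by exact Hu;
      rewrite ?Up, ?Uq; destruct Hw as [-> | ->]; rewrite ?Vp, ?Vq;
      rewrite !wedge_lc_l, !wedge_lc_r.
      - fold X11. rewrite E11. unfold x11, x12, x21, x22, wedge. simpl. ring.
      - fold X12. rewrite E12. unfold x11, x12, x21, x22, wedge. simpl. ring.
      - fold X21. rewrite E21. unfold x11, x12, x21, x22, wedge. simpl. ring.
      - fold X22. rewrite E22. unfold x11, x12, x21, x22, wedge. simpl. ring. }
    assert (Hs' : s = 1 \/ s = -1).
    { assert ((s - 1) * (s + 1) = 0) by lra.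
      destruct (Rmult_integral _ _ H); [left | right]; lra. }
    destruct Hs' as [-> | ->]; [left | right]; apply (mapp_unique _ _ p' q' W');
      rewrite F by tauto; vec; f_equal; ring.
Qed.

(** * From stem quadrants back to lengthening *)

(** As a^2 = 1 + bc, squaring a x + c y gives x^2, a positive definite form in x and y, and 2 a c x
    y, which is nonnegative because [f] is on the closed negative side. The other end is similar. *)
Lemma translation_lengthens p q m a b c s f :
  translation p q m a b c -> wedge p q <> 0 -> f <> (0, 0) -> signed s (a * c) < 0 ->
  signed s (wedge p f * wedge q f) <= 0 ->
  wedge p f ^ 2 < wedge (mapp m p) f ^ 2 /\ wedge q f ^ 2 < wedge (mapp m q) f ^ 2.
Proof.
  intros [Ep [Eq [Ha Hbc]]] W Hf Hs Hn.
  set (x := wedge p f) in *. set (y := wedge q f) in *.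
  assert (N : x <> 0 \/ y <> 0).
  { destruct (Req_dec x 0) as [Zx|]; [|now left]. right. intros Zy. apply Hf.
    apply (vec_unique p q); [exact W | |].
    - fold x. rewrite Zx. vec. ring.
    - fold y. rewrite Zy. vec. ring. }
  rewrite Ep, Eq, !wedge_lc_l. fold x y.
  assert (Hac : 0 <= (a * c) * (x * y)).
  { destruct s; simpl in *; nra. }
  assert (Hab : 0 <= (a * b) * (x * y)).
  { assert (0 < (a * b) * (a * c)).
    { replace (a * b * (a * c)) with ((a * a) * (b * c)) by ring. apply Rmult_lt_0_compat; lra. }
    destruct s; simpl in *; nra. }
  assert (Hc : c <> 0) by (intros ->; lra). assert (Hb : b <> 0) by (intros ->; lra).
  assert (0 < c * c) by nra. assert (0 < b * b) by nra.
  assert (Hx : 0 <= x * x) by apply Rle_0_sqr. assert (Hy : 0 <= y * y) by apply Rle_0_sqr.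
  assert (P1 : 0 < (b * c) * (x * x) + c * c * (y * y)).
  { destruct N; [assert (0 < x * x) by nra | assert (0 < y * y) by nra]; nra. }
  assert (P2 : 0 < (b * c) * (y * y) + b * b * (x * x)).
  { destruct N; [assert (0 < x * x) by nra | assert (0 < y * y) by nra]; nra. }
  assert (Ea : a * a = 1 + b * c) by lra.
  split.
  - apply Rlt_le_trans with (x ^ 2 + ((b * c) * (x * x) + c * c * (y * y))); [lra|].
    replace ((a * x + c * y) ^ 2) with ((a * a) * (x * x) + 2 * (a * c * (x * y)) + c * c * (y * y)) by ring.
    rewrite Ea. lra.
  - apply Rlt_le_trans with (y ^ 2 + ((b * c) * (y * y) + b * b * (x * x))); [lra|].
    replace ((b * x + a * y) ^ 2) with ((a * a) * (y * y) + 2 * (a * b * (x * y)) + b * b * (x * x)) by ring.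
    rewrite Ea. lra.
Qed.

(** Small [t] controls [A] and large [t] controls [B]; this is the passage from the points of a line
    to its ends. *)
Lemma affine_neg (A B : R) : (forall t, 0 < t -> A + t * B < 0) ->
  A <= 0 /\ B <= 0 /\ (A <> 0 \/ B <> 0).
Proof.
  intros H. repeat split.
  - apply Rnot_lt_le. intros L.
    assert (K : 0 < Rabs B + 1) by (pose proof (Rabs_pos B); lra).
    pose proof (H (A / (Rabs B + 1)) (Rdiv_lt_0_compat _ _ L K)) as G.
    pose proof (Rle_abs (- B)) as Q. rewrite Rabs_Ropp in Q.
    assert (E : A / (Rabs B + 1) * (Rabs B + 1) = A) by (field; lra).
    assert (0 < A / (Rabs B + 1)) by now apply Rdiv_lt_0_compat.
    nra.
  - apply Rnot_lt_le. intros L.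
    assert (K : 0 < Rabs A + 1) by (pose proof (Rabs_pos A); lra).
    pose proof (H ((Rabs A + 1) / B) (Rdiv_lt_0_compat _ _ K L)) as G.
    replace ((Rabs A + 1) / B * B) with (Rabs A + 1) in G by (field; lra).
    pose proof (Rle_abs (- A)) as Q. rewrite Rabs_Ropp in Q. lra.
  - destruct (Req_dec A 0); [right | left; assumption].
    intros ->. specialize (H 1). lra.
Qed.

(** Along [l'], parametrised by [point_on_line], the defining function of [l] is affine in [t] up to
    a positive factor, its coefficients being the products at the two ends. An end may be shared
    with [l], but not both. *)
Lemma negative_side_endpoints l l' s : (forall w, on l' w -> neg_side l s w) ->
  let x e e' := wedge (evec e) (evec e') in
  signed s (x (ep1 l) (ep1 l') * x (ep2 l) (ep1 l')) <= 0 /\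
  signed s (x (ep1 l) (ep2 l') * x (ep2 l) (ep2 l')) <= 0 /\
  (x (ep1 l) (ep1 l') * x (ep2 l) (ep1 l') <> 0 \/ x (ep1 l) (ep2 l') * x (ep2 l) (ep2 l') <> 0).
Proof.
  intros H x. unfold x. clear x. pose proof (wedge_ep l') as W.
  set (p := evec (ep1 l)) in *. set (q := evec (ep2 l)) in *.
  set (p' := evec (ep1 l')) in *. set (q' := evec (ep2 l')) in *.
  assert (K : signed s (wedge p q' * wedge q q') <= 0 /\ signed s (wedge p p' * wedge q p') <= 0
     /\ (signed s (wedge p q' * wedge q q') <> 0 \/ signed s (wedge p p' * wedge q p') <> 0)).
  { apply affine_neg. intros t Ht.
    destruct (point_on_line p' q' t W Ht) as [z [Hz [Z1 [Z2 _]]]].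
    assert (Hl : on l' z) by (split; [exact Hz | now rewrite gfun_polar]).
    specialize (H z Hl). apply pos_side_signed in H. destruct H as [_ H].
    rewrite signed_negb in H. fold p q in H.
    pose proof (polar_expand p' q' p q z) as E. rewrite Z1, Z2 in E.
    pose proof (polar_pos p' z Hz (wedge_nonzero_l _ _ W)) as P.
    rewrite (wedge_anti p' p), (wedge_anti p' q) in E.
    assert (0 < wedge p' q' * wedge p' q') by nra.
    assert (G : 0 < - (signed s (wedge p q' * wedge q q') + t * signed s (wedge p p' * wedge q p'))).
    { apply mul_pos_cancel with (polar p' p' z); [exact P|].
      replace (polar p' p' z * _) with (wedge p' q' * wedge p' q' * - signed s (polar p q z)).
      - now apply Rmult_lt_0_compat.
      - apply (f_equal (signed s)) in E. destruct s; simpl in *; lra. }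
    lra. }
  destruct K as [K1 [K2 K3]]. split; [exact K2|]. split; [exact K1|].
  destruct K3 as [K3|K3]; [right | left]; intros Z; apply K3; rewrite Z; destruct s; simpl; ring.
Qed.

(** Multiplying two hypotheses produces the desired product times a square, which cancels because
    its root is nonzero. *)
Lemma same_sign_products (x11 x12 x21 x22 : R) (s s' : bool) :
  signed s (x11 * x21) <= 0 -> signed s (x12 * x22) <= 0 ->
  signed s' (x11 * x12) <= 0 -> signed s' (x21 * x22) <= 0 ->
  x11 * x21 <> 0 \/ x12 * x22 <> 0 ->
  0 <= signed s (signed s' (x11 * x22)) /\ 0 <= signed s (signed s' (x12 * x21)).
Proof.
  assert (K : forall w z, w <> 0 -> 0 <= (w * w) * z -> 0 <= z).
  { intros w z Hw Hz. assert (0 < w * w) by nra. nra. }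
  assert (S : forall u v, signed s u <= 0 -> signed s' v <= 0 -> 0 <= signed s (signed s' (u * v)))
    by (intros; destruct s, s'; simpl in *; nra).
  intros H1 H2 H3 H4 [N|N].
  - assert (x11 <> 0) by (intros ->; apply N; ring). assert (x21 <> 0) by (intros ->; apply N; ring).
    split.
    + apply (K x21); [assumption|]. pose proof (S _ _ H1 H4). destruct s, s'; simpl in *; lra.
    + apply (K x11); [assumption|]. pose proof (S _ _ H1 H3). destruct s, s'; simpl in *; lra.
  - assert (x12 <> 0) by (intros ->; apply N; ring). assert (x22 <> 0) by (intros ->; apply N; ring).
    split.
    + apply (K x12); [assumption|]. pose proof (S _ _ H2 H3). destruct s, s'; simpl in *; lra.
    + apply (K x22); [assumption|]. pose proof (S _ _ H2 H4). destruct s, s'; simpl in *; lra.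
Qed.

Lemma mapp_nonzero m v : SL2 m -> v <> (0, 0) -> mapp m v <> (0, 0).
Proof.
  intros Hm Hv E. apply Hv. rewrite <- (mapp_minv_l m v Hm), E. vec. f_equal; ring.
Qed.

(** Up to sign, e ^ k e' is u e ^ v e', so the area grows twice: [u] increases it since [e'] is on
    the closed negative side of [l], then [v] does since [u e] is still on that of [l']. *)
Lemma condB_lengthens g g' l l' s s' : SL2 g -> SL2 g' ->
  oriented_away l s l' s' -> in_SQ_quot g g' l s l' s' ->
  lengthens (mmul (minv g) g') l l'.
Proof.
  intros Hg Hg' [O1 O2] [u [v [Hu [Hv [Su [Sv E]]]]]].
  set (k := mmul (minv g) g') in *.
  destruct (SQ_elim l s u Hu Su) as [a [b [c [Tu Hac]]]].
  destruct (SQ_elim l' s' v Hv Sv) as [a' [b' [c' [Tv Hac']]]].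
  destruct (negative_side_endpoints l l' s O1) as [N1 [N2 N3]].
  destruct (negative_side_endpoints l' l s' O2) as [N1' [N2' _]].
  pose proof (wedge_ep l) as W. pose proof (wedge_ep l') as W'.
  set (p := evec (ep1 l)) in *. set (q := evec (ep2 l)) in *.
  set (p' := evec (ep1 l')) in *. set (q' := evec (ep2 l')) in *.
  assert (Ek : forall x y, wedge x (mapp k y) ^ 2 = wedge (mapp v y) (mapp u x) ^ 2).
  { intros x y. destruct E as [-> | ->].
    - rewrite mapp_mmul, (wedge_anti x), wedge_minv by exact Hu. ring.
    - transitivity (wedge x (mapp (mmul (minv u) v) y) ^ 2); [vec; ring|].
      rewrite mapp_mmul, (wedge_anti x), wedge_minv by exact Hu. ring. }
  rewrite (wedge_anti p' p), (wedge_anti q' p), Rmult_opp_opp in N1'.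
  rewrite (wedge_anti p' q), (wedge_anti q' q), Rmult_opp_opp in N2'.
  set (x11 := wedge p p') in *. set (x12 := wedge p q') in *.
  set (x21 := wedge q p') in *. set (x22 := wedge q q') in *.
  destruct (same_sign_products x11 x12 x21 x22 s s' N1 N2 N1' N2' N3) as [S1 S2].
  assert (NU : forall e, is_endpoint l e ->
    signed s' (wedge p' (mapp u (evec e)) * wedge q' (mapp u (evec e))) <= 0).
  { pose proof Tu as [Up [Uq [Ha Hbc]]].
    assert (Hab : signed s (a * b) < 0).
    { apply (signed_same _ _ _ Hac). replace (a * c * (a * b)) with ((a * a) * (b * c)) by ring.
      apply Rmult_lt_0_compat; lra. }
    (* The square terms have the right sign because the ends of [l] do, and the cross term by [S1]
       and [S2]. *)
    assert (K : forall t d f, signed s t < 0 ->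
      signed s' (d * d * (x11 * x12) + t * (x11 * x22 + x12 * x21) + f * f * (x21 * x22)) <= 0).
    { intros t d f Ht.
      assert (0 <= d * d) by apply Rle_0_sqr. assert (0 <= f * f) by apply Rle_0_sqr.
      assert (signed s' (t * (x11 * x22 + x12 * x21)) <= 0) by (destruct s, s'; simpl in *; nra).
      destruct s'; simpl in *; nra. }
    intros e [->| ->]; fold p q; rewrite ?Up, ?Uq, !wedge_lc_r,
      (wedge_anti p' p), (wedge_anti p' q), (wedge_anti q' p), (wedge_anti q' q);
      fold x11 x12 x21 x22.
    - replace (_ * _) with (a * a * (x11 * x12) + (a * c) * (x11 * x22 + x12 * x21) + c * c * (x21 * x22))
        by ring. now apply K.
    - replace (_ * _) with (b * b * (x11 * x12) + (a * b) * (x11 * x22 + x12 * x21) + a * a * (x21 * x22))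
        by ring. now apply K. }
  intros e e' He He'. rewrite Ek. fold k.
  apply Rlt_trans with (wedge (evec e') (mapp u (evec e)) ^ 2).
  - replace (wedge (evec e') (mapp u (evec e)) ^ 2) with (wedge (mapp u (evec e)) (evec e') ^ 2)
      by (rewrite wedge_anti; ring).
    assert (Hn : signed s (wedge p (evec e') * wedge q (evec e')) <= 0)
      by (destruct He' as [->| ->]; assumption).
    destruct (translation_lengthens _ _ _ _ _ _ _ _ Tu W (evec_nonzero e') Hac Hn).
    destruct He as [->| ->]; assumption.
  - destruct (translation_lengthens _ _ _ _ _ _ _ _ Tv W'
      (mapp_nonzero _ _ Hu (evec_nonzero e)) Hac' (NU e He)).
    destruct He' as [->| ->]; assumption.
Qed.

Theorem theoremB1 (l l' : geod) (g g' : mat) (Hg : SL2 g) (Hg' : SL2 g') :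
  (crooked_disjoint g l g' l' -> condB l l' g g')
  /\ (forall s s' : bool,
        geod_disjoint l l' -> oriented_away l s l' s' ->
        condB_with l s l' s' g g' -> crooked_disjoint g l g' l').
Proof.
  split.
  - intros A. now apply lengthens_condB, disjoint_lengthens.
  - intros s s' _ O [_ [_ B]]. apply lengthens_disjoint; try assumption.
    now apply condB_lengthens with s s'.
Qed.
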